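(* Let $S=\{x_1,\dots,x_n\}$ be a finite set of points in general position in $\mathbb{R}^d$. The locally optimal triangulation $LOT(S)$ of $S$ constructed by the incremental flipping algorithm (described in the context) is the Delaunay triangulation of $S$.
   Context: General position: no $d+1$ of the points lie on a common hyperplane and no $d+2$ lie on a common sphere. A triangulation of a finite set $A\subset\mathbb{R}^d$ is a triangulation of its convex hull $CH(A)$ whose vertices belong to $A$ (not every point of $A$ need be used). The Delaunay triangulation $DT(A)$ is the triangulation of $A$ whose $d$-simplices are exactly the $d$-simplices with vertices in $A$ whose circumscribed sphere has no point of $A$ in its interior. A triangulation $t$ of $A$ is regular if there is a convex function on $CH(A)$ that is affine on each simplex of $t$ and is given by a different affine function on each maximal cell of $t$. Flip: a set $T$ of $d+2$ points in general position in $\mathbb{R}^d$ has exactly two triangulations. If $T\subset A$, $|T|=d+2$, and one of the two triangulations $\sigma$ of $T$ is a subcomplex of a triangulation $t$ of $A$, then flipping $\sigma$ means replacing $\sigma$ by the other triangulation of $T$, giving a new triangulation of $A$. Parabolic functional: for a triangulation $t$ with $d$-simplices $\Delta_i$ having vertices $x_{i0},\dots,x_{id}$, $Vr(t)=\sum_i(\|x_{i0}\|^2+\dots+\|x_{id}\|^2)\operatorname{vol}(\Delta_i)$. Local optimality: a triangulation $t$ of $A$ is locally non-optimal if it has a convex subcomplex $\sigma$ on $d+2$ vertices (one of the two triangulations of a $(d+2)$-point subset of $A$) such that the triangulation $t'$ obtained by flipping $\sigma$ is regular and $Vr(t')<Vr(t)$; such a $\sigma$ is called a non-optimal $(d+2)$-subcomplex.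 Otherwise $t$ is called locally optimal. The algorithm: choose an artificial set $S_0=\{x_{-d},x_{-d+1},\dots,x_0\}$ of $d+1$ points, the vertices of a $d$-simplex containing $S$, sufficiently far away that $DT(S)$ consists of exactly the simplices of $DT(S\cup S_0)$ not incident to any point of $S_0$ (with $S\cup S_0$ in general position). Put $S_i=S_0\cup\{x_1,\dots,x_i\}$. Let $LOT(S_0)$ be the single simplex with vertex set $S_0$. For $i=1,\dots,n$: locate the $d$-simplex $s$ of $LOT(S_{i-1})$ containing $x_i$; if $LOT(S_{i-1})$, regarded as a triangulation of $S_i$, is not locally optimal, insert $x_i$ by the flip that replaces $s$ by the $d+1$ simplices spanned by $x_i$ and the facets of $s$, and then, while the current triangulation of $S_i$ has a non-optimal $(d+2)$-subcomplex, choose any such subcomplex $\sigma$ and flip it. The resulting triangulation of $S_i$ is $LOT(S_i)$. The output $LOT(S)$ consists of all simplices of $LOT(S_n)$ that are not incident to any point of $S_0$. *)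

(* Defs.v *)
From Stdlib Require Import Relation_Operators.
From mathcomp Require Import all_boot all_order all_algebra.
From mathcomp Require Import classical_sets reals convex.
(* gives the finite-set notions priority over the homonymous classical ones *)
From mathcomp Require Import finset.

Set Implicit Arguments.
Unset Strict Implicit.
Unset Printing Implicit Defensive.

Import Order.TTheory GRing.Theory Num.Theory.
Local Open Scope ring_scope.

Section Configurations.
Variables (R : realType) (d : nat) (I : finType) (p : I -> 'rV[R]_d).
Implicit Types (A T s f g : {set I}) (t sigma : {set {set I}}).

Definition dot (u v : 'rV[R]_d) : R := \sum_j u 0 j * v 0 j.
Definition sqnorm (v : 'rV[R]_d) : R := dot v v.

Definition on_hyperplane s : Prop :=
  exists (u : 'rV[R]_d) (c : R), u != 0 /\ {in s, forall i, dot u (p i) = c}.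

(* [rho] is the square of the radius. *)
Definition circumsphere s (z : 'rV[R]_d) (rho : R) : Prop :=
  {in s, forall i, sqnorm (p i - z) = rho}.

(* Injectivity says that the [p i] are #|I| distinct points. *)
Definition general_position : Prop :=
  [/\ injective p,
      forall s, #|s| = d.+1 -> ~ on_hyperplane s
    & forall s, #|s| = d.+2 -> ~ exists z rho, circumsphere s z rho].

Definition hull A : set 'rV[R]_d := fun v =>
  exists w : I -> R,
    [/\ {in A, forall i, 0 <= w i}, \sum_(i in A) w i = 1
      & v = \sum_(i in A) w i *: p i].

Definition affinely_independent s : Prop :=
  forall w : I -> R, \sum_(i in s) w i = 0 -> \sum_(i in s) w i *: p i = 0 ->
  {in s, forall i, w i = 0}.

(* Simplices are represented by their vertex sets and a triangulation by the
   set of all its (nonempty) simplices, of every dimension.  The hull of the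
   empty set is empty, so that disjoint simplices are covered by the
   intersection clause. *)
Definition triangulation A t : Prop :=
  [/\ forall f, f \in t ->
        [/\ f != set0, f \subset A & affinely_independent f],
      forall f g, f \in t -> g != set0 -> g \subset f -> g \in t,
      forall f g, f \in t -> g \in t ->
        forall v, hull f v -> hull g v -> hull (f :&: g) v
    & forall v, hull A v <-> exists2 f, f \in t & hull f v].

Definition d_simplex s : Prop := #|s| = d.+1 /\ affinely_independent s.

Definition is_delaunay A t : Prop :=
  triangulation A t /\
  forall s, s \subset A -> d_simplex s ->
    (s \in t <-> exists z rho, circumsphere s z rho /\
                   {in A, forall i, rho <= sqnorm (p i - z)}).

Definition coincides_affine (phi : 'rV[R]_d -> R) f (u : 'rV[R]_d) (c : R) :=
  forall v, hull f v -> phi v = dot u v + c.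

Definition maximal_cell t f : bool := maxset (fun g => g \in t) f.

Definition is_regular A t : Prop :=
  triangulation A t /\
  exists phi : 'rV[R]_d -> R,
    [/\ convex_function (hull A) phi,
        forall f, f \in t -> exists u c, coincides_affine phi f u c
      & forall f g, maximal_cell t f -> maximal_cell t g -> f != g ->
          ~ exists u c, coincides_affine phi f u c /\
                        coincides_affine phi g u c].

(* |det (q_1 - q_0, ..., q_d - q_0)| / d!, where q_0, ..., q_d are the vertices
   listed in the (immaterial) order of [enum s]; meaningful if #|s| = d.+1. *)
Definition vol s : R :=
  let q := [seq p i | i <- enum s] in
  `| \det (\matrix_(k < d) (q`_(k.+1) - q`_0)) | / d`!%:R.

Definition Vr t : R :=
  \sum_(s in t | #|s| == d.+1) (\sum_(i in s) sqnorm (p i)) * vol s.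

Definition replace_subcomplex t sigma sigma' := (t :\: sigma) :|: sigma'.

Definition flip A t sigma t' : Prop :=
  exists T sigma',
    [/\ T \subset A /\ #|T| = d.+2,
        [/\ triangulation T sigma, triangulation T sigma' & sigma' != sigma],
        sigma \subset t
      & t' = replace_subcomplex t sigma sigma'].

Definition nonoptimal_flip A t t' : Prop :=
  exists sigma, [/\ flip A t sigma t', is_regular A t' & Vr t' < Vr t].

Definition locally_optimal A t : Prop := ~ exists t', nonoptimal_flip A t t'.

Definition faces s : {set {set I}} := [set f | (f != set0) && (f \subset s)].

Definition cone (q : I) s : {set {set I}} :=
  \bigcup_(i in s) faces (q |: (s :\ i)).

Definition insert_point t s (q : I) : {set {set I}} :=
  replace_subcomplex t (faces s) (cone q s).

End Configurations.

Section Algorithm.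
Variables (R : realType) (d n : nat).
(* [a] lists the artificial points, [x k] is the point usually numbered k+1 *)
Variables (a : 'I_d.+1 -> 'rV[R]_d) (x : 'I_n -> 'rV[R]_d).

Notation J := ('I_d.+1 + 'I_n)%type.

Definition all_points (k : J) : 'rV[R]_d :=
  match k with inl j => a j | inr j => x j end.

(* S_i = S_0 \cup {x_1, ..., x_i} *)
Definition first_points (i : nat) : {set J} :=
  [set k : J | match k with inl _ => true | inr j => (j < i)%N end].

Definition not_artificial (t : {set {set J}}) : {set {set 'I_n}} :=
  [set f : {set 'I_n} | [set (inr j : J) | j in f] \in t].

(* The last clause says that DT(S) consists exactly of the simplices of
   DT(S \cup S_0) that are not incident to S_0. *)
Definition artificial_simplex : Prop :=
  [/\ affinely_independent a [set: 'I_d.+1],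
      forall j, hull a [set: 'I_d.+1] (x j),
      general_position all_points
    & forall t, is_delaunay all_points [set: J] t ->
        is_delaunay x [set: 'I_n] (not_artificial t)].

Definition flip_steps (i : nat) : {set {set J}} -> {set {set J}} -> Prop :=
  clos_refl_trans_1n _ (nonoptimal_flip all_points (first_points i)).

Definition algorithm_step (i : 'I_n) (t t' : {set {set J}}) : Prop :=
  (locally_optimal all_points (first_points i.+1) t /\ t' = t) \/
  (~ locally_optimal all_points (first_points i.+1) t /\
   exists s : {set J},
     [/\ s \in t /\ #|s| = d.+1, hull all_points s (x i),
         flip_steps i.+1 (insert_point t s (inr i)) t'
       & locally_optimal all_points (first_points i.+1) t']).

(* [LOT_upto i t]: some run of the algorithm produces [t] as LOT(S_i). *)
Inductive LOT_upto : nat -> {set {set J}} -> Prop :=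
| LOT_start : LOT_upto 0 (faces (first_points 0))
| LOT_insert (i : 'I_n) t t' :
    LOT_upto i t -> algorithm_step i t t' -> LOT_upto i.+1 t'.

(* The choices made by the algorithm are free, so its output is a relation. *)
Definition LOT (t : {set {set 'I_n}}) : Prop :=
  exists2 u, LOT_upto n u & t = not_artificial u.

Definition flipping_terminates : Prop :=
  forall i, (i <= n)%N -> ~ exists t : nat -> {set {set J}},
    forall k, nonoptimal_flip all_points (first_points i) (t k) (t k.+1).

End Algorithm.

(* Main.v *)
From Stdlib Require Import Relation_Operators ClassicalEpsilon.
Require Import Defs.
From mathcomp Require Import all_boot all_order all_algebra.
From mathcomp Require Import boolp classical_sets reals convex.
From mathcomp Require Import topology normedtype.
From mathcomp Require Import interval_inference.
From mathcomp Require Import fintype finset perm.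
From mathcomp Require Import ring lra.

Set Implicit Arguments.
Unset Strict Implicit.
Unset Printing Implicit Defensive.

Import Order.TTheory GRing.Theory Num.Theory.
Import numFieldNormedType.Exports.
Local Open Scope ring_scope.

(** The lifting [p i |-> (p i, h i)] turns regular triangulations into lower
    convex hulls.  A triangulation is regular exactly when there are heights [h]
    for which the hyperplane through each lifted cell passes strictly below all
    the other lifted points ([heights_of_regular], [regular_of_heights]), and
    for the heights [h i = sqnorm (p i)] this says that every cell has an empty
    circumsphere, so that the triangulation is Delaunay
    ([delaunay_of_supports]).

    Every triangulation met by the algorithm is regular: the initial simplex
    is, a flip is only performed when its result is, and inserting a point into
    a cell keeps regularity ([insert_point_regular]).  Everything therefore
    follows from the fact that a regular triangulation [t] without non-optimal
    flip is Delaunay ([regular_flip_or_delaunay]).  Move the heights of [t]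
    linearly towards the squared norms.  If all the hyperplanes keep passing
    below, [t] is Delaunay.  Otherwise there is a first time when the lifted
    points of some [T] with [#|T| = d.+2] become coplanar; for generic initial
    heights [T] is unique.  The triangulation [t] then contains one of the two
    triangulations of [T], and slightly after that time the lower hull is the
    result of flipping it ([flip_regular]).  The points of [T] have a unique
    affine dependency [w], the vertices of positive and negative coefficient
    give its two triangulations ([half_triangulation]), the volume of [T :\ i]
    is proportional to [`|w i|] ([vol_circuit]), and the change of the
    functional is a positive multiple of [\sum_i w i * sqnorm (p i)]
    ([flip_Vr]).  This sum is negative, because the circuit is positive at the
    heights of [t] and has changed sign on the way to the squared norms.

    Each flip lowers the functional and there are finitely many sets of
    simplices, so flipping terminates ([no_infinite_flipping]) and the
    algorithm has a run ([LOT_upto_ex]).  Its last triangulation is the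
    Delaunay triangulation of all points, and the choice of the artificial
    points makes the simplices away from them Delaunay for the original
    points. *)

(** * Small perturbations *)

Section SmallPerturbations.
Local Open Scope classical_set_scope.
Local Open Scope ring_scope.
Variable R : realType.

(** The stability arguments below all concern quantities depending affinely on
    a small parameter [s > 0]; the filter [0^'+] collects finitely many of them. *)
Lemma near0_line_gt0 (c e : R) : 0 < c -> \forall s \near 0^'+, 0 < c + s * e.
Proof.
move=> c0; have e0 : 0 < `|e| + 1 by rewrite ltr_wpDl.
near=> s.
have s0 : 0 < s by near: s; exact: nbhs_right_gt.
have : s < c / (`|e| + 1) by near: s; apply: nbhs_right_lt; rewrite divr_gt0.
rewrite ltr_pdivlMr // => sc.
have : - (s * e) <= s * `|e| by rewrite -mulrN ler_pM2l // ler_normr lexx orbT.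
nra.
Unshelve. all: by end_near. Qed.

Lemma near0_line_neq0 (c e : R) : (c != 0) || (e != 0) ->
  \forall s \near 0^'+, c + s * e != 0.
Proof.
have [-> /= e0|c0 _] := eqVneq c 0.
  near=> s; have s0 : 0 < s by near: s; exact: nbhs_right_gt.
  by rewrite add0r mulf_neq0 // gt_eqF.
have [{}c0|{}c0|/eqP] := ltgtP c 0; last by rewrite (negbTE c0).
  near=> s; have : 0 < - c + s * - e.
    by near: s; apply: near0_line_gt0; rewrite oppr_gt0.
  by rewrite mulrN -opprD oppr_gt0 => /lt_eqF ->.
near=> s; have : 0 < c + s * e by near: s; exact: near0_line_gt0.
by move=> /gt_eqF ->.
Unshelve. all: by end_near. Qed.

(** A form vanishing at the current point is repaired by moving one coordinate
    on which the form depends, and a small enough move preserves the previous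
    inequalities. *)
Lemma positive_avoiding_zeros (I K : finType) (L : K -> I -> R) :
  exists2 eta : I -> R, (forall i, 0 < eta i) &
    forall k, (exists i, L k i != 0) -> \sum_i L k i * eta i != 0.
Proof.
suff [eta eta0 Leta] : exists2 eta : I -> R, (forall i, 0 < eta i) &
    forall k, k \in enum K -> (exists i, L k i != 0) -> \sum_i L k i * eta i != 0.
  by exists eta => // k; apply: Leta; rewrite mem_enum.
elim: (enum K) => [|k ks [eta eta0 Leta]]; first by exists (fun=> 1).
have [[i Lki]|Lk0] := pselect (exists i, L k i != 0); last first.
  exists eta => // k'; rewrite inE => /predU1P[->//|]; exact: Leta.
pose move_i s j := eta j + s * (j == i)%:R.
have moveE k' s :
    \sum_j L k' j * move_i s j = \sum_j L k' j * eta j + s * L k' i.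
  under eq_bigr => j _ do rewrite mulrDr.
  rewrite big_split /=; congr (_ + _).
  rewrite (bigD1 i) //= eqxx mulr1 mulrC big1 ?addr0 // => j /negbTE ->.
  by rewrite !mulr0.
have : \forall s \near 0^'+, forall k', k' \in k :: ks ->
    (exists j, L k' j != 0) -> \sum_j L k' j * move_i s j != 0.
  apply: filter_forall => k'.
  have [|] := boolP (k' \in k :: ks); last by move=> _; near=> s.
  rewrite inE => kks.
  have : (\sum_j L k' j * eta j != 0) || (L k' i != 0) \/
         ~ (exists j, L k' j != 0).
    have [Lk'|Lk'] := pselect (exists j, L k' j != 0); last by right.
    left; case/predU1P: kks => [->|k'ks]; first by rewrite Lki orbT.
    by rewrite Leta.
  case=> [/near0_line_neq0|Lk']; last by near=> s.
  by apply: filterS => s; rewrite moveE.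
move=> Hs; near ((0 : R)^'+) => s.
exists (move_i s).
  by move=> j; rewrite ltr_wpDr // mulr_ge0 ?ler0n //.
by near: s.
Unshelve. all: by end_near. Qed.

End SmallPerturbations.

(** * Affine functions, barycentric coordinates and circuits *)

Section Barycentric.
Variables (R : realType) (d : nat) (I : finType) (p : I -> 'rV[R]_d).
Implicit Types (A T f g : {set I}) (v : 'rV[R]_d) (w h : I -> R).
Implicit Types (l : 'rV[R]_d * R).

Definition affine_fun l v : R := dot l.1 v + l.2.

Definition combination w : 'rV[R]_d := \sum_i w i *: p i.

Definition barycentric f w v : Prop :=
  [/\ forall i, i \notin f -> w i = 0, \sum_i w i = 1 & combination w = v].

Lemma dot_combination (u : 'rV[R]_d) w :
  dot u (combination w) = \sum_i w i * dot u (p i).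
Proof.
rewrite /dot /combination.
under eq_bigr => j _ do rewrite summxE mulr_sumr.
rewrite exchange_big /=; apply: eq_bigr => i _.
by rewrite mulr_sumr; apply: eq_bigr => j _; rewrite mxE mulrCA.
Qed.

Lemma affine_fun_barycentric l f w v : barycentric f w v ->
  affine_fun l v = \sum_i w i * affine_fun l (p i).
Proof.
case=> _ w1 <-; rewrite /affine_fun dot_combination -[X in _ + X]mul1r -w1.
by rewrite mulr_suml -big_split; apply: eq_bigr => i _; rewrite mulrDr.
Qed.

Lemma affine_fun_line l v v' (s : R) :
  affine_fun l ((1 - s) *: v + s *: v') =
  (1 - s) * affine_fun l v + s * affine_fun l v'.
Proof.
rewrite /affine_fun /dot !mulrDr !mulr_sumr.
under eq_bigr => j _ do rewrite !mxE mulrDr.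
rewrite big_split /=.
under eq_bigr => j _ do rewrite mulrCA.
under [X in _ + X + _]eq_bigr => j _ do rewrite mulrCA.
ring.
Qed.

Lemma affine_funB l l' v : affine_fun (l - l') v = affine_fun l v - affine_fun l' v.
Proof.
rewrite /affine_fun /dot opprD addrACA; congr (_ + _); rewrite -sumrB.
by apply: eq_bigr => j _; rewrite !mxE mulrBl.
Qed.

Lemma hullP f v :
  hull p f v <-> exists2 w, barycentric f w v & forall i, 0 <= w i.
Proof.
split=> [[w [w0 w1 ->]]|[w [wf w1 wv] w0]].
  pose w' i := if i \in f then w i else 0.
  exists w'; last by move=> i; rewrite /w'; case: ifP => // /w0.
  split; first by move=> i /negbTE; rewrite /w' => ->.
    by rewrite -w1 [RHS]big_mkcond.
  rewrite /combination [RHS]big_mkcond; apply: eq_bigr => i _ /=.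
  by rewrite /w'; case: ifP; rewrite ?scale0r.
exists w; split => //.
  rewrite -w1 big_mkcond; apply: eq_bigr => i _ /=.
  by case: ifPn => // /wf.
rewrite -wv /combination [RHS]big_mkcond; apply: eq_bigr => i _ /=.
by case: ifPn => // /wf ->; rewrite scale0r.
Qed.

Lemma hull_sub f g v : f \subset g -> hull p f v -> hull p g v.
Proof.
move=> /subsetP fg /hullP[w [wf w1 wv] w0]; apply/hullP; exists w => //.
by split=> // i /(contra (@fg i)); exact: wf.
Qed.

Lemma barycentric_line f w v w' v' (s : R) :
  barycentric f w v -> barycentric f w' v' ->
  barycentric f (fun i => (1 - s) * w i + s * w' i) ((1 - s) *: v + s *: v').
Proof.
move=> [wf w1 <-] [wf' w1' <-]; split.
- by move=> i fi; rewrite wf ?wf' // !mulr0 addr0.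
- by rewrite big_split /= -!mulr_sumr w1 w1' !mulr1 subrK.
- rewrite /combination !scaler_sumr -big_split; apply: eq_bigr => i _.
  by rewrite /= !scalerA -scalerDl.
Qed.

Lemma hull_line f v v' (s : R) : 0 <= s <= 1 ->
  hull p f v -> hull p f v' -> hull p f ((1 - s) *: v + s *: v').
Proof.
move=> /andP[s0 s1] /hullP[w wv w0] /hullP[w' wv' w0']; apply/hullP.
exists (fun i => (1 - s) * w i + s * w' i); first exact: barycentric_line.
by move=> i; rewrite addr_ge0 ?mulr_ge0 ?subr_ge0.
Qed.

Lemma hull_vertex f i : i \in f -> hull p f (p i).
Proof.
move=> fi; apply/hullP; exists (fun j => (j == i)%:R); last by move=> j; rewrite ler0n.
split; first by move=> j fj; case: eqP fi fj => // -> ->.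
  by rewrite (bigD1 i) //= eqxx big1 ?addr0 // => j /negbTE ->.
rewrite /combination (bigD1 i) //= eqxx scale1r big1 ?addr0 // => j /negbTE ->.
by rewrite scale0r.
Qed.

Lemma enum_cell f n : #|f| = n ->
  exists2 e : 'I_n -> I, injective e & f = [set e k | k : 'I_n].
Proof.
move=> fn; exists (fun k => enum_val (cast_ord (esym fn) k)).
  by move=> k k' /enum_val_inj /cast_ord_inj.
apply/setP => i; apply/idP/imsetP => [fi|[k _ ->]]; last exact: enum_valP.
exists (cast_ord fn (enum_rank_in fi i)) => //.
by rewrite cast_ordK enum_rankK_in.
Qed.

Lemma sum_enum_cell (V : nmodType) f n (e : 'I_n -> I) (F : I -> V) :
    injective e -> f = [set e k | k : 'I_n] ->
    (forall i, i \notin f -> F i = 0) ->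
  \sum_i F i = \sum_k F (e k).
Proof.
move=> e_inj -> F0; rewrite (bigID (mem [set e k | k : 'I_n])) /=.
rewrite [X in _ + X]big1 ?addr0 => [|i]; last exact: F0.
by rewrite big_imset //= => k k' _ _; exact: e_inj.
Qed.

(** The rows are the points of a cell in homogeneous coordinates, so that
    multiplying on the right evaluates affine functions at the vertices and
    multiplying on the left forms affine combinations. *)
Definition lift_mx (e : 'I_d.+1 -> I) : 'M[R]_d.+1 :=
  \matrix_k (row_mx (const_mx 1 : 'M_1) (p (e k)) : 'rV_(1 + d)).

Lemma lift_mxEl e k : lift_mx e k (lshift d (ord0 : 'I_1)) = 1.
Proof. by rewrite mxE row_mxEl mxE. Qed.

Lemma lift_mxEr e k j : lift_mx e k (rshift 1 j) = p (e k) 0 j.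
Proof. by rewrite mxE row_mxEr. Qed.

Lemma lift_mx_mulr e (x : 'cV[R]_(1 + d)) k :
  (lift_mx e *m x) k 0 = affine_fun ((dsubmx x)^T, x (lshift d ord0) 0) (p (e k)).
Proof.
rewrite mxE [LHS](@big_split_ord _ _ _ 1 d) /= big_ord1 addrC /affine_fun /dot.
congr (_ + _); last by rewrite lift_mxEl mul1r.
by apply: eq_bigr => j _; rewrite lift_mxEr mulrC !mxE.
Qed.

Section GeneralPosition.
Hypothesis gen_lin : forall f, #|f| = d.+1 -> ~ on_hyperplane p f.

(** A vector in the kernel is an affine function vanishing at all the vertices,
    that is, a hyperplane through them. *)
Lemma lift_mx_unit e : injective e -> lift_mx e \in unitmx.
Proof.
move=> e_inj; rewrite unitmxE unitfE -det_tr; apply/negP => /det0P[v v0 vM].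
pose x : 'cV[R]_(1 + d) := v^T; pose u := (dsubmx x)^T; pose c := x (lshift d ord0) 0.
have lift0 k : dot u (p (e k)) = - c.
  apply/eqP; rewrite -subr_eq0 opprK -[_ + _]/(affine_fun (u, c) _) -lift_mx_mulr.
  by apply/eqP; rewrite -[_ *m _]trmxK trmx_mul trmxK vM !mxE.
have [u0|u0] := eqVneq u 0.
  have c0 : c = 0.
    apply/eqP; rewrite -oppr_eq0 -(lift0 ord0) u0 /dot big1 // => j _.
    by rewrite mxE mul0r.
  case/eqP: v0; apply/rowP => j; rewrite [RHS]mxE.
  case: (split_ordP (j : 'I_(1 + d))) => k ->; first by rewrite [k]ord1 -c0 [RHS]mxE.
  by move/rowP: u0 => /(_ k); rewrite !mxE.
apply: (@gen_lin [set e k | k : 'I_d.+1]); first by rewrite card_imset // card_ord.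
by exists u, (- c); split=> // _ /imsetP[k _ ->].
Qed.

Lemma interpolation f h : #|f| = d.+1 ->
  exists l, {in f, forall i, affine_fun l (p i) = h i}.
Proof.
move=> /enum_cell[e e_inj ->].
pose x : 'cV[R]_(1 + d) := invmx (lift_mx e) *m (\col_k h (e k)).
exists ((dsubmx x)^T, x (lshift d ord0) 0) => _ /imsetP[k _ ->].
by rewrite -lift_mx_mulr mulKVmx ?lift_mx_unit // mxE.
Qed.

Lemma barycentric_ex f v : #|f| = d.+1 -> exists w, barycentric f w v.
Proof.
move=> /enum_cell[e e_inj fE].
pose c : 'rV[R]_d.+1 := (row_mx (const_mx 1 : 'M_1) v : 'rV_(1 + d)) *m invmx (lift_mx e).
have cM : c *m lift_mx e = row_mx (const_mx 1 : 'M_1) v :> 'rV_(1 + d).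
  by rewrite mulmxKV ?lift_mx_unit.
pose w i := \sum_(k | e k == i) c 0 k.
have we k : w (e k) = c 0 k.
  by rewrite /w (big_pred1 k) // => k'; rewrite (inj_eq e_inj).
have wf i : i \notin f -> w i = 0.
  move=> fi; rewrite /w big1 // => k /eqP ki; case/negP: fi.
  by rewrite fE -ki imset_f.
exists w; split=> //.
  rewrite (sum_enum_cell e_inj fE) //.
  have /rowP/(_ (lshift d ord0)) := cM; rewrite row_mxEl mxE [RHS]mxE => <-.
  by apply: eq_bigr => k _; rewrite lift_mxEl mulr1.
apply/rowP => j; rewrite /combination summxE.
rewrite (sum_enum_cell e_inj fE) => [|i /wf ->]; last by rewrite scale0r mxE.
have /rowP/(_ (rshift 1 j)) := cM; rewrite row_mxEr mxE => <-.
by apply: eq_bigr => k _; rewrite lift_mxEr mxE we.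
Qed.

(** The coordinate at [i] is the affine function interpolating the indicator
    of [i] on the vertices. *)
Lemma barycentric_coordinate f i : #|f| = d.+1 -> i \in f ->
  exists l, forall w v, barycentric f w v -> w i = affine_fun l v.
Proof.
move=> fd fi; have [l lf] := interpolation (fun j => (j == i)%:R) fd.
exists l => w v wv; rewrite (affine_fun_barycentric _ wv) (bigD1 i) //= lf //.
rewrite eqxx mulr1 big1 ?addr0 // => j ji; case: wv => wf _ _.
have [jf|/wf ->] := boolP (j \in f); last by rewrite mul0r.
by rewrite lf // (negbTE ji) mulr0.
Qed.

Lemma barycentric_uniq f w w' v : #|f| = d.+1 ->
  barycentric f w v -> barycentric f w' v -> w = w'.
Proof.
move=> fd wv wv'; apply/funext => i.
have [fi|fi] := boolP (i \in f).
  by have [l lE] := barycentric_coordinate fd fi; rewrite (lE _ _ wv) (lE _ _ wv').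
by case: wv wv' => wf _ _ [wf' _ _]; rewrite wf ?wf'.
Qed.

Definition dependency T w : Prop :=
  [/\ forall i, i \notin T -> w i = 0, \sum_i w i = 0 & combination w = 0].

Lemma dependency_cell f w : #|f| = d.+1 -> dependency f w -> w = fun=> 0.
Proof.
move=> fd [wf w0 wc]; have [i fi] : exists i, i \in f by apply/set0Pn; rewrite -card_gt0 fd.
have [b bv] := barycentric_ex (p i) fd.
suff bwb : (fun j => b j + w j) = b.
  by apply/funext => j; apply/(addrI (b j)); rewrite addr0; exact: (congr1 (fun w => w j) bwb).
apply: (barycentric_uniq fd _ bv); case: bv => bf b1 bc; split.
- by move=> k fk; rewrite bf ?wf ?addr0.
- by rewrite big_split /= b1 w0 addr0.
- rewrite -[RHS]addr0 -bc -wc /combination -big_split /=.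
  by apply: eq_bigr => k _; rewrite scalerDl.
Qed.

Lemma sub_cell_independent f g : #|f| = d.+1 -> g \subset f ->
  affinely_independent p g.
Proof.
move=> fd /subsetP gf w w0 wc i gi.
have /(congr1 (fun w => w i)) : (fun j => if j \in g then w j else 0) = fun=> 0.
  apply: (dependency_cell fd); split.
  - by move=> j; move/(contra (@gf j)) => /negbTE ->.
  - by rewrite -big_mkcond.
  - rewrite -wc /combination [RHS]big_mkcond; apply: eq_bigr => j _ /=.
    by case: ifP; rewrite ?scale0r.
by rewrite gi.
Qed.

(** In general position every (d+2)-set carries exactly one dependency up to
    scaling, and none of its coefficients vanishes. *)
Definition circuit T w : Prop :=
  [/\ #|T| = d.+2, dependency T w & {in T, forall i, w i != 0}].

(** A dependency vanishing at one vertex is supported on a cell, hence zero. *)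
Lemma dependency_circuit T w j : #|T| = d.+2 -> dependency T w ->
  w j != 0 -> circuit T w.
Proof.
move=> Td [wT w0 wc] wj; split=> // i Ti; apply: contra_neq wj => wi.
have Tid : #|T :\ i| = d.+1 by apply/eqP; rewrite -eqSS -Td (cardsD1 i T) Ti.
have -> // : w = fun=> 0.
apply: (dependency_cell Tid); split=> // k.
by rewrite !inE negb_and negbK => /predU1P[->//|/wT].
Qed.

Lemma circuit_mem T w i : circuit T w -> (i \in T) = (w i != 0).
Proof.
case=> _ [wT _ _] w0; apply/idP/idP; first exact: w0.
by apply: contraR => /wT ->.
Qed.

Lemma circuit_opp T w : circuit T w -> circuit T (fun i => - w i).
Proof.
case=> Td [wT w0 wc] wn0; split=> //; last by move=> i /wn0; rewrite oppr_eq0.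
split; first by move=> i /wT ->; rewrite oppr0.
  by rewrite sumrN w0 oppr0.
rewrite -oppr0 -wc /combination -sumrN; apply: eq_bigr => i _.
by rewrite scaleNr.
Qed.

Lemma card_setD1_circuit T i : #|T| = d.+2 -> i \in T -> #|T :\ i| = d.+1.
Proof. by move=> Td Ti; apply/eqP; rewrite -eqSS -Td (cardsD1 i T) Ti. Qed.

Lemma affine_fun_circuit l T w : circuit T w -> \sum_i w i * affine_fun l (p i) = 0.
Proof.
case=> _ [_ w0 wc] _; rewrite /affine_fun.
under eq_bigr => i _ do rewrite mulrDr.
rewrite big_split /= -dot_combination -mulr_suml w0 wc mul0r addr0.
by rewrite /dot big1 // => j _; rewrite mxE mulr0.
Qed.

(** Subtract the multiple of the circuit that cancels one coefficient: what
    remains is a dependency of a cell. *)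
Lemma dependency_proportional T w w' : circuit T w -> dependency T w' ->
  exists c, w' = fun i => c * w i.
Proof.
move=> [Td [wT w0 wc] wn0] [wT' w0' wc'].
have [i Ti] : exists i, i \in T by apply/set0Pn; rewrite -card_gt0 Td.
exists (w' i / w i); apply/funext => j; apply/eqP; rewrite -subr_eq0; apply/eqP.
suff /(congr1 (fun u => u j)) : (fun j => w' j - w' i / w i * w j) = fun=> 0 by [].
apply: (@dependency_cell (T :\ i)); rewrite ?card_setD1_circuit //; split.
- move=> k; rewrite !inE negb_and negbK => /predU1P[->|kT].
    by rewrite divfK ?subrr ?wn0.
  by rewrite (wT k) ?(wT' k) // mulr0 subrr.
- by rewrite sumrB -mulr_sumr w0 w0' mulr0 subrr.
- rewrite /combination; under eq_bigr => k _ do rewrite scalerBl -scalerA.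
  rewrite sumrB -scaler_sumr -[X in X - _]/(combination w') -/(combination w).
  by rewrite wc wc' scaler0 subrr.
Qed.

End GeneralPosition.
End Barycentric.

(** * The two triangulations of a circuit *)

Section Circuits.
Variables (R : realType) (d : nat) (I : finType) (p : I -> 'rV[R]_d).
Implicit Types (A T P f g : {set I}) (t : {set {set I}}) (v : 'rV[R]_d) (w h : I -> R).
Hypothesis gen_lin : forall f, #|f| = d.+1 -> ~ on_hyperplane p f.

(** For the positive vertices [P] of a circuit of [T], this is the
    triangulation of [T] with maximal simplices [T :\ i], [i \in P]; it is the
    set of lower faces of [T] when its lifted points satisfy
    [0 < \sum_i w i * h i]. *)
Definition half T P : {set {set I}} :=
  [set f | [&& f != set0, f \subset T & ~~ (P \subset f)]].

Definition positive_part w : {set I} := [set i | 0 < w i].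

Lemma pos_sub T w : circuit p T w -> positive_part w \subset T.
Proof.
by move=> wT; apply/subsetP => i; rewrite inE (circuit_mem _ wT) => /gt_eqF ->.
Qed.

Lemma circuit_pos_ex T w : circuit p T w -> exists i, 0 < w i.
Proof.
move=> [Td [wT w0 _] wn0]; apply/not_existsP => w_le0.
have [i Ti] : exists i, i \in T by apply/set0Pn; rewrite -card_gt0 Td.
have : \sum_i - w i == 0 by rewrite sumrN w0 oppr0.
rewrite psumr_eq0 => [/allP/(_ i)|j _]; last first.
  by rewrite oppr_ge0 leNgt; apply/negP/w_le0.
by rewrite mem_index_enum oppr_eq0 (negbTE (wn0 i Ti)) => /(_ isT).
Qed.

Lemma half_setD1 T P f : P \subset T -> f \in half T P ->
  exists2 i, i \in P & f \subset T :\ i.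
Proof.
move=> PT; rewrite inE => /and3P[_ fT /subsetPn[i Pi fi]].
by exists i => //; rewrite subsetD1 fT.
Qed.

Lemma setD1_half T P i : P \subset T -> #|T| = d.+2 -> i \in T ->
  (T :\ i \in half T P) = (i \in P).
Proof.
move=> PT Td Ti; rewrite inE -card_gt0 (card_setD1_circuit Td Ti) subsetDl /=.
by rewrite subsetD1 PT /= negbK.
Qed.

Lemma half_cell T P f : P \subset T -> #|T| = d.+2 -> #|f| = d.+1 ->
  f \in half T P -> exists2 i, i \in P & f = T :\ i.
Proof.
move=> PT Td fd /(half_setD1 PT)[i Pi fTi]; exists i => //.
by apply/eqP; rewrite eqEcard fTi fd (card_setD1_circuit Td (subsetP PT _ Pi)) leqnn.
Qed.

(** Sliding a convex combination along the circuit until a coefficient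
    vanishes: the first one to vanish in the direction [- w] has [0 < w i]. *)
Lemma hull_circuit T w v : circuit p T w -> hull p T v ->
  exists2 i, 0 < w i & hull p (T :\ i) v.
Proof.
move=> wT /hullP[a [aT a1 av] a0]; have [i0 wi0] := circuit_pos_ex wT.
case: (@Order.TotalTheory.arg_minP _ _ _ i0 (fun i => 0 < w i) (fun i => a i / w i) wi0).
move=> i wi imin.
exists i => //; apply/hullP; exists (fun j => a j - a i / w i * w j).
  case: wT => _ [wT w0 wc] _; split.
  - move=> j; rewrite !inE negb_and negbK => /predU1P[->|jT].
      by rewrite divfK ?subrr ?gt_eqF.
    by rewrite (wT j) ?(aT j) // mulr0 subrr.
  - by rewrite sumrB -mulr_sumr w0 mulr0 subr0.
  - rewrite /combination; under eq_bigr => k _ do rewrite scalerBl -scalerA.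
    by rewrite sumrB -scaler_sumr -/(combination p w) wc scaler0 subr0.
move=> j; rewrite subr_ge0; have [wj|wj] := ltP 0 (w j).
  by rewrite -ler_pdivlMr // imin.
by rewrite (le_trans _ (a0 j)) // mulr_ge0_le0 // divr_ge0 // ltW.
Qed.

(** The difference [b - c] is a multiple of the circuit.  As [b] vanishes at a
    positive vertex the factor is nonpositive, and as [c] does, nonnegative. *)
Lemma half_barycentric T w f g b c v : circuit p T w ->
  f \in half T (positive_part w) -> g \in half T (positive_part w) ->
  barycentric p f b v -> (forall i, 0 <= b i) ->
  barycentric p g c v -> (forall i, 0 <= c i) -> b = c.
Proof.
move=> wT fH gH bv b0 cv c0; have PT := pos_sub wT.
have [i] := half_setD1 PT fH; have [j] := half_setD1 PT gH.
rewrite !inE => wj /subsetP gTj wi /subsetP fTi.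
have bi : b i = 0 by case: bv => + _ _; apply; apply/negP => /fTi; rewrite !inE eqxx.
have cj : c j = 0 by case: cv => + _ _; apply; apply/negP => /gTj; rewrite !inE eqxx.
have : dependency p T (fun k => b k - c k).
  case: bv cv => bf b1 bc [cg c1 cc]; split.
  - move=> k kT; rewrite bf ?cg ?subrr //.
      by apply/negP => /gTj; rewrite inE (negbTE kT) andbF.
    by apply/negP => /fTi; rewrite inE (negbTE kT) andbF.
  - by rewrite sumrB b1 c1 subrr.
  - rewrite /combination; under eq_bigr => k _ do rewrite scalerBl.
    by rewrite sumrB [X in X - _]bc [X in _ - X]cc subrr.
case/(dependency_proportional gen_lin wT) => s sE.
have sEk k : b k - c k = s * w k := congr1 (fun u => u k) sE.
have s0 : s = 0.
  apply/le_anti; rewrite -(pmulr_lle0 _ wi) -(pmulr_lge0 _ wj) -!sEk bi cj.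
  by rewrite sub0r subr0 oppr_le0 c0 b0.
by apply/funext => k; apply/eqP; rewrite -subr_eq0 sEk s0 mul0r.
Qed.

Lemma barycentricI f g w v : barycentric p f w v -> barycentric p g w v ->
  barycentric p (f :&: g) w v.
Proof.
move=> [wf w1 wv] [wg _ _]; split=> // i; rewrite inE negb_and.
by case/orP; [exact: wf|exact: wg].
Qed.

Lemma half_triangulation T w : circuit p T w ->
  triangulation p T (half T (positive_part w)).
Proof.
move=> wT; have PT := pos_sub wT; have [Td _ _] := wT; split.
- move=> f fH; move: (fH); rewrite inE => /and3P[f0 fT _]; split=> //.
  have [i /(subsetP PT) Ti fTi] := half_setD1 PT fH.
  exact: (sub_cell_independent gen_lin (card_setD1_circuit Td Ti) fTi).
- move=> f g; rewrite !inE => /and3P[_ fT Pf] -> gf.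
  by rewrite (subset_trans gf fT); apply: contra Pf => /subset_trans; exact.
- move=> f g fH gH v /hullP[b bv b0] /hullP[c cv c0].
  apply/hullP; exists b => //; apply: barycentricI => //.
  by rewrite (half_barycentric wT fH gH bv b0 cv c0).
- move=> v; split=> [/(hull_circuit wT)[i wi vi]|[f]]; last first.
    by rewrite inE => /and3P[_ fT _]; exact: hull_sub.
  have Pi : i \in positive_part w by rewrite inE.
  by exists (T :\ i) => //; rewrite setD1_half // (subsetP PT).
Qed.

Lemma flip_circuit A t T w : circuit p T w -> T \subset A ->
  half T (positive_part w) \subset t ->
  flip p A t (half T (positive_part w))
    (replace_subcomplex t (half T (positive_part w)) (half T (positive_part (fun i => - w i)))).
Proof.
move=> wT TA Ht; have [Td _ _] := wT; have wN := circuit_opp wT.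
exists T, (half T (positive_part (fun i => - w i))); split=> //.
split; [exact: half_triangulation|exact: half_triangulation|].
have [i wi] := circuit_pos_ex wT; have Pi : i \in positive_part w by rewrite inE.
have Ti := subsetP (pos_sub wT) _ Pi.
apply/eqP => /setP/(_ (T :\ i)); rewrite !setD1_half ?pos_sub // Pi.
by rewrite inE oppr_gt0 ltNge (ltW wi).
Qed.

(** Expand along the changed row: its cofactors are those of [B], and pairing
    them with the rows of [B] gives the determinant or zero. *)
Lemma det_replace_row n (B C : 'M[R]_n) k0 (c : 'rV_n) :
    (forall k, k != k0 -> row k C = row k B) -> row k0 C = c *m B ->
  \det C = c 0 k0 * \det B.
Proof.
move=> CB C0; rewrite (expand_det_row C k0).
have cofE m : cofactor C k0 m = cofactor B k0 m.
  rewrite /cofactor; congr (_ * \det _); apply/matrixP => k k'; rewrite !mxE.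
  have kk0 : lift k0 k != k0 by rewrite eq_sym neq_lift.
  by have /rowP/(_ (lift m k')) := CB _ kk0; rewrite !mxE.
transitivity ((c *m (B *m \adj B)) 0 k0).
  rewrite mulmxA -C0 mxE; apply: eq_bigr => m _.
  by rewrite cofE !mxE.
by rewrite mul_mx_adj mul_mx_scalar mxE mulrC.
Qed.

(** Subtracting the first row from the others reduces the determinant in
    homogeneous coordinates to the one of the edge vectors; another enumeration
    of the vertices only changes its sign. *)
Lemma vol_enum f (e : 'I_d.+1 -> I) : injective e -> f = [set e k | k : 'I_d.+1] ->
  vol p f = `|\det (lift_mx p e)| / d`!%:R.
Proof.
move=> e_inj fE; rewrite /vol; congr (_ / _).
have fd : #|f| = d.+1 by rewrite fE card_imset // card_ord.
have [i0 fi0] : exists i, i \in f by apply/set0Pn; rewrite -card_gt0 fd.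
pose e0 (k : 'I_d.+1) := nth i0 (enum f) k.
have szf : size (enum f) = d.+1 by rewrite -cardE fd.
have e0_inj : injective e0.
  move=> k k' /eqP; rewrite nth_uniq ?szf ?enum_uniq // => /eqP; exact: val_inj.
have detE : \det (lift_mx p e0) =
    \det (\matrix_(k < d) ([seq p i | i <- enum f]`_(k.+1) - [seq p i | i <- enum f]`_0)).
  set D := (X in _ = \det X).
  have -> : lift_mx p e0 = block_mx 1%:M 0 (const_mx 1) 1%:M *m
      block_mx (1%:M : 'M_1) (p (e0 ord0)) 0 D :> 'M_(1 + d).
    rewrite mulmx_block !mul1mx !mul0mx !addr0 mulmx1; apply/matrixP => k l.
    case: (split_ordP (l : 'I_(1 + d))) => l' ->; case: (split_ordP (k : 'I_(1 + d))) => k' ->.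
    - by rewrite block_mxEul [l']ord1 [k']ord1 lift_mxEl mxE.
    - by rewrite block_mxEdl [l']ord1 lift_mxEl mxE.
    - by rewrite block_mxEur lift_mxEr [k']ord1; congr (p (e0 _) _ _); apply: val_inj.
    rewrite block_mxEdr lift_mxEr !mxE big_ord1 !mxE mul1r.
    rewrite (nth_map i0) ?szf ?ltnS // (nth_map i0) ?szf //.
    by rewrite addrC subrK.
  by rewrite det_mulmx (@det_lblock _ 1 d) (@det_ublock _ 1 d) !det1 !mul1r.
rewrite -detE.
have /fin_all_exists[s sE] : forall k, exists k', e0 k' = e k.
  move=> k; have : e k \in enum f by rewrite mem_enum fE imset_f.
  move=> ekf; have ltk : (index (e k) (enum f) < d.+1)%N by rewrite -szf index_mem.
  by exists (Ordinal ltk); rewrite /e0 /= nth_index.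
have s_inj : injective s by move=> k k' /(congr1 e0); rewrite !sE; exact: e_inj.
have -> : lift_mx p e = perm_mx (perm s_inj) *m lift_mx p e0.
  rewrite -row_permE; apply/matrixP => k l; rewrite [RHS]mxE permE.
  by rewrite /lift_mx [LHS]mxE [RHS]mxE sE.
by rewrite det_mulmx det_perm normrMsign.
Qed.

Lemma vol_gt0 f : #|f| = d.+1 -> 0 < vol p f.
Proof.
move=> /enum_cell[e e_inj fE]; rewrite (vol_enum e_inj fE) divr_gt0 ?ltr0n ?fact_gt0 //.
by rewrite normr_gt0 -unitfE -unitmxE lift_mx_unit.
Qed.

(** Cramer's rule: as the circuit expresses [p j] by the vertices of [T :\ j],
    exchanging the vertex [i] for [j] multiplies the determinant by
    [- w i / w j]. *)
Lemma vol_circuit T w i j : circuit p T w -> i \in T -> j \in T ->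
  `|w i| * vol p (T :\ j) = `|w j| * vol p (T :\ i).
Proof.
move=> wT Ti Tj; have [->//|ij] := eqVneq i j; have [Td [wT0 w0 wc] wn0] := wT.
have [e e_inj eE] := enum_cell (card_setD1_circuit Td Tj).
have [k0 _ ik0] : exists2 k, k \in 'I_d.+1 & i = e k.
  by apply/imsetP; rewrite -eE !inE ij.
pose e' k := if k == k0 then j else e k.
have eT k : e k \in T :\ j by rewrite eE imset_f.
have ej k : e k != j by move: (eT k); rewrite !inE => /andP[].
have e'_inj : injective e'.
  move=> k k'; rewrite /e'; case: eqP => [->|_]; case: eqP => [->//|_].
  - by move/eqP; rewrite eq_sym (negbTE (ej _)).
  - by move/eqP; rewrite (negbTE (ej _)).
  - exact: e_inj.
have e'E : T :\ i = [set e' k | k : 'I_d.+1].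
  apply/eqP; rewrite eq_sym eqEcard (card_setD1_circuit Td Ti) card_imset // card_ord leqnn andbT.
  apply/subsetP => _ /imsetP[k _ ->]; rewrite /e' !inE.
  have [_|kk0] := eqVneq k k0; first by rewrite eq_sym ij.
  rewrite ik0 (inj_eq e_inj) kk0 /=.
  by move: (eT k); rewrite !inE => /andP[].
rewrite (vol_enum e_inj eE) (vol_enum e'_inj e'E) !mulrA; congr (_ / _).
pose c : 'rV[R]_d.+1 := \row_k (- w (e k) / w j).
have sumT (V : zmodType) (F : I -> V) : (forall k, k \notin T -> F k = 0) ->
    \sum_k F k = F j + \sum_k F (e k).
  move=> F0; rewrite (bigD1 j) //=; congr (_ + _).
  rewrite big_mkcond /= (sum_enum_cell e_inj eE).
    by apply: eq_bigr => k _; rewrite ej.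
  by move=> k; rewrite !inE; case: eqP => //= _ /F0.
have -> : \det (lift_mx p e') = c 0 k0 * \det (lift_mx p e).
  apply: det_replace_row => [k kk0|].
    by apply/rowP => l; rewrite !mxE /e' (negbTE kk0).
  apply/rowP => l; rewrite [LHS]mxE [RHS]mxE.
  case: (split_ordP (l : 'I_(1 + d))) => l' ->.
    rewrite [l']ord1 lift_mxEl; under eq_bigr => k _ do rewrite lift_mxEl mulr1 mxE mulNr.
    apply/(mulfI (wn0 j Tj)); rewrite mulr1 mulr_sumr.
    apply/eqP; rewrite -subr_eq0 -sumrN -[X in _ == X]w0 (sumT _ w) //.
    by apply/eqP; congr (_ + _); apply: eq_bigr => k _; rewrite mulrN opprK mulrC divfK ?wn0.
  rewrite lift_mxEr /e' eqxx; under eq_bigr => k _ do rewrite lift_mxEr mxE.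
  apply/(mulfI (wn0 j Tj)); rewrite mulr_sumr.
  have /rowP/(_ l') := wc; rewrite /combination summxE (sumT _ (fun k => (w k *: p k) 0 l')).
    rewrite !mxE => /eqP; rewrite addr_eq0 => /eqP ->; rewrite -sumrN.
    by apply: eq_bigr => k _; rewrite !mxE mulrA mulrCA divff ?wn0 // mulr1 mulNr.
  by move=> k /wT0 ->; rewrite scale0r mxE.
rewrite mxE -ik0 normrM normrM normfV normrN [RHS]mulrA; congr (_ * _).
by rewrite mulrCA divff ?mulr1 // normr_eq0 wn0.
Qed.

Lemma sum_half T w (F : {set I} -> R) : circuit p T w ->
  \sum_(s in half T (positive_part w) | #|s| == d.+1) F s = \sum_(i in positive_part w) F (T :\ i).
Proof.
move=> wT; have PT := pos_sub wT; have [Td _ _] := wT.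
rewrite -(big_imset (h := fun i => T :\ i) F) /=; last first.
  move=> i j /(subsetP PT) Ti /(subsetP PT) Tj /setP/(_ i).
  by rewrite !inE eqxx Ti andbT; case: eqP.
apply: eq_bigl => s; apply/andP/imsetP => [[sH /eqP sd]|[i Pi ->]].
  by have [i Pi ->] := half_cell PT Td sd sH; exists i.
have Ti := subsetP PT _ Pi.
by rewrite setD1_half // (card_setD1_circuit Td Ti).
Qed.

(** The cell [T :\ i] contributes [Q - sqnorm (p i)] times its volume
    [kappa * `|w i|], where [Q] is the sum of the squared norms over [T].  With
    the signs of [w] the two triangulations combine into one sum over [T], from
    which [Q] disappears since [\sum_i w i = 0]. *)
Lemma Vr_half T w : circuit p T w ->
  exists2 kappa, 0 < kappa &
    Vr p (half T (positive_part (fun i => - w i))) - Vr p (half T (positive_part w)) =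
    kappa * \sum_i w i * sqnorm (p i).
Proof.
move=> wT; have [Td [wT0 w0 _] wn0] := wT; have wN := circuit_opp wT.
have [j Tj] : exists i, i \in T by apply/set0Pn; rewrite -card_gt0 Td.
exists (vol p (T :\ j) / `|w j|).
  by rewrite divr_gt0 ?normr_gt0 ?wn0 // vol_gt0 ?(card_setD1_circuit Td).
set kappa := _ / _; rewrite /Vr (sum_half _ wT) (sum_half _ wN).
set Q := \sum_(i in T) sqnorm (p i).
have term i : i \in T ->
    (\sum_(k in T :\ i) sqnorm (p k)) * vol p (T :\ i) = (Q - sqnorm (p i)) * (kappa * `|w i|).
  move=> Ti; rewrite /Q (big_setD1 i Ti) /= [sqnorm _ + _]addrC addrK; congr (_ * _).
  rewrite /kappa mulrAC [_ * `|w i|]mulrC (vol_circuit wT Ti Tj) mulrAC divff ?mul1r //.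
  by rewrite normr_eq0 wn0.
have sumP u : circuit p T u -> (forall i, `|u i| = `|w i|) ->
    \sum_(i in positive_part u) (\sum_(k in T :\ i) sqnorm (p k)) * vol p (T :\ i) =
    kappa * \sum_(i in positive_part u) (Q - sqnorm (p i)) * u i.
  move=> uT uw; rewrite mulr_sumr; apply: eq_bigr => i Pi.
  rewrite term ?(subsetP (pos_sub uT)) // -uw mulrCA; congr (_ * (_ * _)).
  by apply: gtr0_norm; move: Pi; rewrite inE.
rewrite (sumP w) // (sumP (fun i => - w i)) //; last by move=> i; rewrite normrN.
rewrite -mulrBr; congr (_ * _).
transitivity (- \sum_i (Q - sqnorm (p i)) * w i); last first.
  rewrite -sumrN; under eq_bigr => i _ do rewrite mulrBl opprB.
  rewrite sumrB -mulr_sumr w0 mulr0 subr0.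
  by apply: eq_bigr => i _; rewrite mulrC.
rewrite big_mkcond [X in _ - X]big_mkcond /= -sumrB -sumrN.
apply: eq_bigr => i _; rewrite !inE oppr_gt0.
by case: (ltgtP (w i) 0) => [||->]; rewrite ?mulrN ?mulr0 ?subr0 ?sub0r ?oppr0.
Qed.

End Circuits.

(** * Heights and lower faces *)

Section Heights.
Local Open Scope classical_set_scope.
Local Open Scope ring_scope.
Variables (R : realType) (d : nat) (I : finType) (p : I -> 'rV[R]_d).
Implicit Types (A T P f g : {set I}) (t : {set {set I}}) (v : 'rV[R]_d).
Implicit Types (w h : I -> R).
Hypothesis gen_lin : forall f, #|f| = d.+1 -> ~ on_hyperplane p f.

Definition coord f v : I -> R :=
  epsilon (inhabits (fun=> 0)) (fun w => barycentric p f w v).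

Lemma coordP f v : #|f| = d.+1 -> barycentric p f (coord f v) v.
Proof. by move=> /(barycentric_ex gen_lin v); exact: epsilon_spec. Qed.

(** Height of the lifted point [j] above the hyperplane through the lifted
    vertices of the cell [f]. *)
Definition gap f h j : R := h j - \sum_i coord f (p j) i * h i.

(** The circuit of [j |: f] normalized at [j]: a positive gap and a positive
    value of this circuit at the heights are the same thing. *)
Definition gap_coef f j i : R := (i == j)%:R - coord f (p j) i.

Lemma gap_coefE f h j : gap f h j = \sum_i gap_coef f j i * h i.
Proof.
rewrite /gap /gap_coef; under [RHS]eq_bigr => i _ do rewrite mulrBl.
rewrite sumrB; congr (_ - _); rewrite (bigD1 j) //= eqxx mul1r big1 ?addr0 //.
by move=> i /negbTE ->; rewrite mul0r.
Qed.

Lemma gap_linear f (a b : R) h h' j :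
  gap f (fun i => a * h i + b * h' i) j = a * gap f h j + b * gap f h' j.
Proof.
rewrite !gap_coefE !mulr_sumr -big_split; apply: eq_bigr => i _ /=.
by rewrite mulrDr !(mulrCA (gap_coef _ _ _)).
Qed.

Lemma gapE l f h j : #|f| = d.+1 -> {in f, forall i, affine_fun l (p i) = h i} ->
  gap f h j = h j - affine_fun l (p j).
Proof.
move=> fd lf; have cP := coordP (p j) fd.
rewrite (affine_fun_barycentric _ cP) /gap; congr (_ - _).
apply: eq_bigr => i _; case: cP => cf _ _.
by have [/lf ->|/cf ->] := boolP (i \in f); rewrite ?mul0r.
Qed.

Lemma gap_coef_circuit f j : #|f| = d.+1 -> j \notin f ->
  circuit p (j |: f) (gap_coef f j).
Proof.
move=> fd fj; have [cf c1 cv] := coordP (p j) fd.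
apply: (@dependency_circuit _ _ _ _ gen_lin _ _ j).
- by rewrite cardsU1 fj fd.
- split.
  + by move=> i; rewrite !inE negb_or /gap_coef => /andP[/negbTE -> /cf ->]; rewrite subrr.
  + rewrite sumrB c1 (bigD1 j) //= eqxx big1 ?addr0 ?subrr // => i /negbTE -> //.
  + rewrite /combination; under eq_bigr => i _ do rewrite scalerBl.
    rewrite sumrB [X in _ - X]cv (bigD1 j) //= eqxx scale1r big1 ?addr0 ?subrr //.
    by move=> i /negbTE ->; rewrite scale0r.
- by rewrite /gap_coef eqxx cf // subr0 oner_neq0.
Qed.

(** Subtracting from [h] the affine function through the lifted cell does not
    change the sum and leaves only the term at [j]. *)
Lemma circuit_gap T w h j : circuit p T w -> j \in T ->
  \sum_i w i * h i = w j * gap (T :\ j) h j.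
Proof.
move=> wT Tj; have [Td [wT0 _ _] _] := wT; have Tjd := card_setD1_circuit Td Tj.
have [l lT] := interpolation gen_lin h Tjd.
transitivity (\sum_i w i * (h i - affine_fun l (p i))).
  under [RHS]eq_bigr => i _ do rewrite mulrBr.
  by rewrite sumrB (affine_fun_circuit l wT) subr0.
rewrite (gapE _ Tjd lT) (bigD1 j) //= big1 ?addr0 // => i ij.
have [Ti|/wT0 ->] := boolP (i \in T); last by rewrite mul0r.
by rewrite lT ?subrr ?mulr0 // !inE ij.
Qed.

(** When the lifted points of [T] are coplanar all cells of [T] span the same
    hyperplane. *)
Lemma gap_coplanar T w h i m j : circuit p T w -> \sum_k w k * h k = 0 ->
  i \in T -> m \in T -> gap (T :\ i) h j = gap (T :\ m) h j.
Proof.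
move=> wT wh Ti Tm; have [Td _ wn0] := wT.
have Tid := card_setD1_circuit Td Ti; have Tmd := card_setD1_circuit Td Tm.
have [l lm] := interpolation gen_lin h Tmd.
have lT : {in T, forall k, affine_fun l (p k) = h k}.
  move=> k Tk; have [->|km] := eqVneq k m; last by rewrite lm // !inE km.
  apply/eqP; rewrite eq_sym -subr_eq0 -(gapE _ Tmd lm).
  by rewrite -(mulrI_eq0 _ (mulfI (wn0 m Tm))) -(circuit_gap h wT Tm) wh.
by rewrite !(gapE (l := l)) // => k; rewrite inE => /andP[_ /lT].
Qed.

Definition supports h A f : Prop := {in A :\: f, forall j, 0 < gap f h j}.

Definition cells t : {set {set I}} := [set f in t | #|f| == d.+1].

Lemma cellsP t f : reflect (f \in t /\ #|f| = d.+1) (f \in cells t).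
Proof. by rewrite inE; apply: (iffP andP) => -[ft /eqP]. Qed.

(** A convex combination of lifted points lies above both hyperplanes, so over
    [v] each hyperplane is weakly below the other one.  Both heights agree, the
    coordinates vanish at the vertices strictly above either hyperplane, and
    both combinations are supported on [f]. *)
Lemma supports_barycentric h A f g b c v :
    #|f| = d.+1 -> #|g| = d.+1 -> f \subset A -> g \subset A ->
    supports h A f -> supports h A g ->
    barycentric p f b v -> (forall i, 0 <= b i) ->
    barycentric p g c v -> (forall i, 0 <= c i) -> b = c.
Proof.
move=> fd gd fA gA fh gh bv b0 cv c0.
have excess (k u : {set I}) (x : I -> R) : #|k| = d.+1 -> supports h A k -> barycentric p u x v ->
    u \subset A -> (forall i, 0 <= x i) -> forall l,
    {in k, forall i, affine_fun l (p i) = h i} ->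
    (forall i, 0 <= x i * (h i - affine_fun l (p i))) /\
    (\sum_i x i * (h i - affine_fun l (p i)) = 0 -> forall i, i \notin k -> x i = 0).
  move=> kd kh [xu _ _] /subsetP uA x0 l lk.
  have above i : i \in u -> i \notin k -> 0 < h i - affine_fun l (p i).
    by move=> ui ki; rewrite -(gapE _ kd lk) kh // inE ki uA.
  have term0 i : 0 <= x i * (h i - affine_fun l (p i)).
    have [ki|ki] := boolP (i \in k); first by rewrite lk // subrr mulr0.
    have [ui|/xu ->] := boolP (i \in u); last by rewrite mul0r.
    by rewrite mulr_ge0 // ltW // above.
  split=> // /eqP; rewrite psumr_eq0 // => /allP sum0 i ki.
  have := sum0 i; rewrite mem_index_enum => /(_ isT).
  have [ui|/xu //] := boolP (i \in u).
  by rewrite mulf_eq0 (gt_eqF (above _ ui ki)) orbF => /eqP.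
have [l lf] := interpolation gen_lin h fd.
have [m mg] := interpolation gen_lin h gd.
have hv (u : {set I}) (x : I -> R) l' : barycentric p u x v ->
    {in u, forall i, affine_fun l' (p i) = h i} ->
    affine_fun l' v = \sum_i x i * h i.
  move=> xv l'u; rewrite (affine_fun_barycentric _ xv); apply: eq_bigr => i _.
  by case: xv => xu _ _; have [/l'u ->|/xu ->] := boolP (i \in u); rewrite ?mul0r.
have [c_ge0 c_eq0] := excess _ _ _ fd fh cv gA c0 _ lf.
have [b_ge0 _] := excess _ _ _ gd gh bv fA b0 _ mg.
have cE : \sum_i c i * (h i - affine_fun l (p i)) = affine_fun m v - affine_fun l v.
  rewrite (hv _ _ _ cv mg) (affine_fun_barycentric _ cv) -sumrB.
  by apply: eq_bigr => i _; rewrite mulrBr.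
have bE : \sum_i b i * (h i - affine_fun m (p i)) = affine_fun l v - affine_fun m v.
  rewrite (hv _ _ _ bv lf) (affine_fun_barycentric _ bv) -sumrB.
  by apply: eq_bigr => i _; rewrite mulrBr.
have lm : affine_fun m v - affine_fun l v = 0.
  apply/eqP; rewrite eq_le -cE sumr_ge0 ?andbT => [|i _]; last exact: c_ge0.
  by rewrite cE -oppr_ge0 opprB -bE sumr_ge0.
apply: (barycentric_uniq gen_lin fd bv); case: cv => _ c1 cc; split=> //.
by apply: c_eq0; rewrite cE.
Qed.

Lemma barycenter f : f != set0 ->
  exists w v, [/\ barycentric p f w v, forall i, 0 <= w i & {in f, forall i, 0 < w i}].
Proof.
rewrite -card_gt0 => f0; exists (fun i => if i \in f then #|f|%:R^-1 else 0).
eexists; split.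
- split; last by reflexivity.
    by move=> i /negbTE ->.
  by rewrite -big_mkcond sumr_const -[_ *+ _]mulr_natr mulVf // pnatr_eq0 -lt0n.
- by move=> i; case: ifP; rewrite ?invr_ge0 ?ler0n.
- by move=> i ->; rewrite invr_gt0 ltr0n.
Qed.

Definition covers A t : Prop :=
  forall v, hull p A v -> exists2 g, g \in t & hull p g v.

(** The barycenter of [f] lies in some cell of [t], which has the same
    coordinates by [supports_barycentric] and must contain all vertices of [f]. *)
Lemma supports_mem h A t f : covers A (cells t) ->
    {in cells t, forall g, g \subset A /\ supports h A g} ->
    f \subset A -> #|f| = d.+1 -> supports h A f -> f \in t.
Proof.
move=> cov supp fA fd fh.
have f0 : f != set0 by rewrite -card_gt0 fd.
have [w [v [wv w0 wf]]] := barycenter f0.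
have [|g gt /hullP[c cv c0]] := cov v; first by apply: (hull_sub fA); apply/hullP; exists w.
have [gA gh] := supp _ gt; have /cellsP[{}gt gd] := gt.
have wc := supports_barycentric fd gd fA gA fh gh wv w0 cv c0.
suff -> : f = g by [].
apply/eqP; rewrite eqEcard fd gd leqnn andbT; apply/subsetP => i /wf wi.
by apply: contraLR wi => gi; rewrite wc; case: cv => -> //; rewrite ltxx.
Qed.

Lemma card_between A (B : {set I}) n : A \subset B -> (#|A| <= n <= #|B|)%N ->
  exists C : {set I}, [/\ A \subset C, C \subset B & #|C| = n].
Proof.
elim: n => [|n IHn] AB /andP[An nB].
  by exists A; split=> //; apply/eqP; rewrite -leqn0.
move: An; rewrite leq_eqVlt => /predU1P[An|An]; first by exists A.
have [|C [AC CB Cn]] := IHn AB; first by rewrite -ltnS An ltnW.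
have [i iB iC] : exists2 i, i \in B & i \notin C.
  by apply/subsetPn; apply: contraTN nB => /subset_leq_card; rewrite Cn -ltnNge.
exists (i |: C); rewrite subUset sub1set iB CB cardsU1 iC Cn; split=> //.
exact: subset_trans AC (subsetUr _ _).
Qed.

Lemma affinely_independent_card f : affinely_independent p f -> (#|f| <= d.+1)%N.
Proof.
move=> f_ind; rewrite leqNgt; apply/negP => fd.
have [|T [_ Tf Td]] := @card_between set0 f d.+2 (sub0set _); first by rewrite cards0.
have [j Tj] : exists i, i \in T by apply/set0Pn; rewrite -card_gt0 Td.
have := @gap_coef_circuit (T :\ j) j; rewrite !inE eqxx setD1K // => /(_ _ isT).
case/(_ (card_setD1_circuit Td Tj)) => _ [wT w0 wc] wn0; have := wn0 j Tj.
rewrite (f_ind (gap_coef (T :\ j) j)) ?eqxx ?(subsetP Tf) //.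
  rewrite -[RHS]w0 [LHS]big_mkcond; apply: eq_bigr => i _ /=; case: ifPn => // fi.
  by rewrite wT //; apply: contra fi; exact: (subsetP Tf).
rewrite -[RHS]wc /combination [LHS]big_mkcond; apply: eq_bigr => i _ /=; case: ifPn => // fi.
by rewrite wT ?scale0r //; apply: contra fi; exact: (subsetP Tf).
Qed.

Lemma independent_barycentric_uniq f w w' v : affinely_independent p f ->
  barycentric p f w v -> barycentric p f w' v -> w = w'.
Proof.
move=> f_ind [wf w1 wv] [wf' w1' wv']; apply/funext => i.
have [fi|fi] := boolP (i \in f); last by rewrite wf ?wf'.
apply/eqP; rewrite -subr_eq0; apply/eqP.
have mkc (V : nmodType) (F : I -> V) : (forall j, j \notin f -> F j = 0) ->
    \sum_(j in f) F j = \sum_j F j.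
  by move=> F0; rewrite big_mkcond; apply: eq_bigr => j _ /=; case: ifPn => // /F0.
apply: (f_ind (fun j => w j - w' j)) => //; rewrite mkc.
- by rewrite sumrB w1 w1' subrr.
- by move=> j fj; rewrite wf ?wf' ?subrr.
- under eq_bigr => j _ do rewrite scalerBl.
  by rewrite sumrB [X in X - _]wv [X in _ - X]wv' subrr.
- by move=> j fj; rewrite wf ?wf' ?subrr ?scale0r.
Qed.

(** Provides a hyperplane through a lower dimensional face that misses a vertex
    of [f0], so that generic points of the hull of [f0] avoid it. *)
Lemma low_face_affine_fun f f0 : #|f0| = d.+1 -> (#|f| <= d)%N ->
  exists l, {in f, forall i, affine_fun l (p i) = 0} /\
            exists2 i, i \in f0 & affine_fun l (p i) != 0.
Proof.
move=> fd0 fd; have [i i0 fi] : exists2 i, i \in f0 & i \notin f.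
  by apply/subsetPn; apply: contraTN fd => /subset_leq_card; rewrite fd0 -ltnNge.
have [||g [fg _ gd]] := @card_between (i |: f) [set: I] d.+1.
- exact: subsetT.
- by rewrite cardsU1 fi ltnS fd -fd0 subset_leq_card ?subsetT.
have [l lg] := interpolation gen_lin (fun j => (j == i)%:R) gd.
exists l; split=> [j fj|].
  rewrite lg ?(subsetP fg) ?inE ?fj ?orbT //.
  by case: eqP fi => [<-|//]; rewrite fj.
by exists i => //; rewrite lg ?(subsetP fg) ?setU11 // eqxx oner_neq0.
Qed.

(** A segment from [v] towards a generic point [b] leaves every lower
    dimensional face immediately, and every cell not containing [v] too; hence
    a short initial piece of it lies in a cell containing [v].  The point [b]
    can also be kept away from finitely many prescribed hyperplanes. *)
Lemma generic_segment A t f0 (K : finType) (L : K -> 'rV[R]_d * R) :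
    triangulation p A t -> f0 \subset A -> #|f0| = d.+1 ->
  exists2 b, hull p f0 b &
    (forall k, (exists2 i, i \in f0 & affine_fun (L k) (p i) != 0) ->
       affine_fun (L k) b != 0) /\
    forall v, hull p A v -> exists2 g, g \in cells t &
      hull p g v /\ exists2 s : R, 0 < s < 1 & hull p g ((1 - s) *: v + s *: b).
Proof.
move=> [tP _ _ tcov] f0A fd0.
have /fin_all_exists[M MP] : forall f : {set I}, exists l, (#|f| <= d)%N ->
    {in f, forall i, affine_fun l (p i) = 0} /\
    exists2 i, i \in f0 & affine_fun l (p i) != 0.
  move=> f; have [|_] := leqP #|f| d; last by exists 0.
  by move=> /(low_face_affine_fun fd0)[l]; exists l.
pose val_at (k : K + {set I}) i :=
  if i \in f0 then affine_fun (match k with inl k => L k | inr f => M f end) (p i) else 0.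
have [eta eta0 eta_avoid] := positive_avoiding_zeros val_at.
pose S := \sum_(i in f0) eta i.
have S0 : 0 < S.
  have [i fi] : exists i, i \in f0 by apply/set0Pn; rewrite -card_gt0 fd0.
  by rewrite /S (bigD1 i) //= ltr_wpDr // sumr_ge0 // => j _; rewrite ltW.
pose w i := if i \in f0 then eta i / S else 0.
have w1 : \sum_i w i = 1 by rewrite -big_mkcond -mulr_suml mulfV // gt_eqF.
pose b := combination p w.
have wb : barycentric p f0 w b by split=> // i /negbTE; rewrite /w => ->.
have b0 : hull p f0 b.
  by apply/hullP; exists w => // i; rewrite /w; case: ifP => // _; rewrite divr_ge0 // ltW.
have b_avoid k : (exists2 i, i \in f0 &
      affine_fun (match k with inl k => L k | inr f => M f end) (p i) != 0) ->
    affine_fun (match k with inl k => L k | inr f => M f end) b != 0.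
  move=> [i fi ki]; rewrite (affine_fun_barycentric _ wb).
  have -> : \sum_i w i * affine_fun (match k with inl k => L k | inr f => M f end) (p i) =
      (\sum_i val_at k i * eta i) / S.
    rewrite mulr_suml; apply: eq_bigr => j _; rewrite /w /val_at.
    by case: ifP => _; rewrite ?mul0r // mulrC mulrA.
  by rewrite mulf_neq0 ?invr_eq0 ?(gt_eqF S0) // eta_avoid //; exists i; rewrite /val_at fi.
exists b => //; split=> [k ki|v vA]; first exact: (b_avoid (inl k)).
pose y s := (1 - s) *: v + s *: b.
have near_cell f : \forall s \near 0^'+, f \in t -> hull p f (y s) -> #|f| = d.+1 /\ hull p f v.
  have [ft|] := boolP (f \in t); last by move=> _; near=> s.
  have [_ _ /affinely_independent_card] := tP f ft.
  rewrite leq_eqVlt => /predU1P[fd|]; last first.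
    rewrite ltnS => fd; have [Mf0 Mf] := MP f fd.
    have Mb := b_avoid (inr f) Mf.
    have near_s : \forall s \near 0^'+,
        affine_fun (M f) v + s * (affine_fun (M f) b - affine_fun (M f) v) != 0.
      apply: near0_line_neq0; have [->|//] := eqVneq (affine_fun (M f) v) 0.
      by rewrite subr0 Mb orbT.
    apply: filterS near_s => s; set z := _ + _ => z0 _ /hullP[c cy _].
    case/eqP: z0; transitivity (affine_fun (M f) (y s)).
      by rewrite affine_fun_line /z; ring.
    rewrite (affine_fun_barycentric _ cy) big1 // => i _; case: cy => cf _ _.
    by have [/Mf0 ->|/cf ->] := boolP (i \in f); rewrite ?mulr0 ?mul0r.
  have [vf|vf] := pselect (hull p f v); first by near=> s.
  have cv := coordP v fd; have cb := coordP b fd.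
  have [i ci] : exists i, coord f v i < 0.
    apply: contrapT => /forallNP c_ge0; apply: vf; apply/hullP; exists (coord f v) => // i.
    by rewrite leNgt; apply/negP.
  have near_s : \forall s \near 0^'+, 0 < - coord f v i + s * (coord f v i - coord f b i).
    by apply: near0_line_gt0; rewrite oppr_gt0.
  apply: filterS near_s => s si _ /hullP[c cy c0]; suff : c i < 0 by rewrite ltNge c0.
  have -> : c i = (1 - s) * coord f v i + s * coord f b i.
    by rewrite (barycentric_uniq gen_lin fd cy (barycentric_line s cv cb)).
  lra.
near ((0 : R)^'+) => s.
have s0 : 0 < s by near: s; exact: nbhs_right_gt.
have s1 : s < 1 by near: s; exact: nbhs_right_lt.
have [|g gt gy] := (tcov (y s)).1.
  by apply: hull_line; rewrite ?ltW //; exact: hull_sub b0.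
have s_cell : forall f, f \in t -> hull p f (y s) -> #|f| = d.+1 /\ hull p f v.
  by near: s; apply: filter_forall.
have [gd gv] := s_cell g gt gy; exists g; first exact/cellsP.
by split=> //; exists s; rewrite ?s0.
Unshelve. all: by end_near. Qed.

Lemma triangulation_covers A t f0 : triangulation p A t -> f0 \subset A ->
  #|f0| = d.+1 -> covers A (cells t).
Proof.
move=> tA f0A fd0; have [b _ [_ H]] := generic_segment (fun k : 'I_0 => 0) tA f0A fd0.
by move=> v /H[g gt [gv _]]; exists g.
Qed.

(** A cell containing the barycenter of [f] meets [f] in a face containing an
    interior point, that is, in [f] itself. *)
Lemma triangulation_pure A t f0 f : triangulation p A t -> f0 \subset A ->
  #|f0| = d.+1 -> f \in t -> exists2 g, g \in cells t & f \subset g.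
Proof.
move=> tA f0A fd0 ft; have cov := triangulation_covers tA f0A fd0.
case: tA => tP _ tI _; have [f_neq0 fA f_ind] := tP f ft.
have [w [v [wv w0 wf]]] := barycenter f_neq0.
have fv : hull p f v by apply/hullP; exists w.
have [g gt gv] := cov v (hull_sub fA fv); exists g => //.
have /cellsP[{}gt _] := gt.
have /hullP[c cv _] := tI f g ft gt v fv gv.
have cf : barycentric p f c v.
  by case: cv => cfg c1 cc; split=> // i fi; rewrite cfg // inE (negbTE fi).
apply/subsetP => i /wf; rewrite (independent_barycentric_uniq f_ind wv cf).
by apply: contraLR => gi; case: cv => -> //; rewrite ?ltxx // inE (negbTE gi) andbF.
Qed.

End Heights.

(** * Regular triangulations and heights *)

Section Regularity.
Local Open Scope classical_set_scope.
Local Open Scope ring_scope.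
Variables (R : realType) (d : nat) (I : finType) (p : I -> 'rV[R]_d).
Implicit Types (A T P f g : {set I}) (t : {set {set I}}) (v : 'rV[R]_d).
Implicit Types (w h : I -> R).
Hypothesis gen_lin : forall f, #|f| = d.+1 -> ~ on_hyperplane p f.

Lemma convex_hullP A (phi : 'rV[R]_d -> R) :
  convex_function (hull p A) phi <->
  forall v v' (s : R), hull p A v -> hull p A v' -> 0 < s < 1 ->
    phi ((1 - s) *: v + s *: v') <= (1 - s) * phi v + s * phi v'.
Proof.
split=> [phi_cvx v v' s vA v'A /andP[s0 s1]|phi_cvx s v v' /set_mem vA /set_mem v'A].
  have x0 : 0 <= 1 - s by rewrite subr_ge0 ltW.
  have x1 : 1 - s <= 1 by rewrite gerBl ltW.
  have onemK' : 1 - (1 - s) = s by rewrite opprB addrC subrK.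
  have H : phi ((1 - s) *: v + (1 - (1 - s)) *: v') <=
           (1 - s) * phi v + (1 - (1 - s)) * phi v'.
    exact: phi_cvx (Itv01 x0 x1) v v' (mem_set vA) (mem_set v'A).
  by rewrite onemK' in H.
have x0 : 0 <= s%:inum by []. have x1 : s%:inum <= 1 by [].
change (phi (s%:inum *: v + (1 - s%:inum) *: v') <=
        s%:inum * phi v + (1 - s%:inum) * phi v').
move: (s%:inum) x0 x1 => x x0 x1; have [->|x_neq0] := eqVneq x 0.
  by rewrite !scale0r !mul0r !add0r !subr0 !scale1r !mul1r.
have [->|x_neq1] := eqVneq x 1.
  by rewrite subrr !scale0r !mul0r !addr0 !scale1r !mul1r.
have := phi_cvx v v' (1 - x) vA v'A.
have -> : 1 - (1 - x) = x by ring.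
apply.
by rewrite subr_gt0 gtrBl !lt_neqAle x_neq1 eq_sym x_neq0 x0 x1.
Qed.

Section HeightsOfRegular.
Variables (A f0 : {set I}) (t : {set {set I}}).
Hypotheses (f0A : f0 \subset A) (fd0 : #|f0| = d.+1).

Lemma cell_maximal f : triangulation p A t -> f \in cells d t -> maximal_cell t f.
Proof.
move=> [tP _ _ _] /cellsP[ft fd]; apply/maxsetP; split=> // g gt fg.
have [_ _ /(affinely_independent_card gen_lin) gd] := tP g gt.
by apply/esym/eqP; rewrite eqEcard fg fd.
Qed.

(** The segment from the barycenter of [f] to [v] starts inside [f], where the
    function is affine; convexity bounds its value at the far end. *)
Lemma convex_above_cell (phi : 'rV[R]_d -> R) f l v :
    convex_function (hull p A) phi -> f \subset A -> #|f| = d.+1 ->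
    (forall v, hull p f v -> phi v = affine_fun l v) ->
  hull p A v -> affine_fun l v <= phi v.
Proof.
move=> /convex_hullP phi_cvx fA fd phi_l vA.
have f_neq0 : f != set0 by rewrite -card_gt0 fd.
have [w [b [wb w0 wf]]] := barycenter p f_neq0.
have fb : hull p f b by apply/hullP; exists w.
have cv := coordP gen_lin v fd.
have near_f : \forall s \near 0^'+, forall i, i \in f -> 0 < w i + s * (coord p f v i - w i).
  apply: filter_forall => i; have [fi|] := boolP (i \in f); last by move=> _; near=> s.
  by have := near0_line_gt0 (coord p f v i - w i) (wf i fi); apply: filterS.
near ((0 : R)^'+) => s.
have s0 : 0 < s by near: s; exact: nbhs_right_gt.
have s1 : s < 1 by near: s; exact: nbhs_right_lt.
have fy : hull p f ((1 - s) *: b + s *: v).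
  apply/hullP; exists (fun i => (1 - s) * w i + s * coord p f v i).
    exact: barycentric_line.
  move=> i; have [fi|fi] := boolP (i \in f); last first.
    by case: wb cv => wf0 _ _ [cf _ _]; rewrite wf0 // cf // !mulr0 addr0.
  have : 0 < w i + s * (coord p f v i - w i) by move: i fi; near: s.
  lra.
have := phi_cvx b v s (hull_sub fA fb) vA; rewrite s0 s1 => /(_ isT).
rewrite (phi_l _ fy) affine_fun_line (phi_l _ fb) lerD2l ler_pM2l //.
Unshelve. all: by end_near. Qed.

(** Vertices of [t] get the height prescribed by the convex function, the other
    points of [A] a larger one.  If a vertex [p j] outside a cell [f] were on
    the hyperplane of [f], the function would be affine on the hull of [f] and
    [p j].  A generic segment from [p j] into [f] starts in a cell [g]
    containing [p j], so that [f] and [g] would share their affine function. *)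
Lemma heights_of_regular : is_regular p A t ->
  exists h, {in cells d t, forall f, supports p h A f}.
Proof.
move=> [tA [phi [phi_cvx phi_aff phi_max]]]; have [tP t_down tI tcov] := tA.
have /fin_all_exists[L LP] : forall f : {set I}, exists l, f \in t ->
    forall v, hull p f v -> phi v = affine_fun l v.
  move=> f; have [ft|_] := boolP (f \in t); last by exists 0.
  by have [u [c uc]] := phi_aff f ft; exists (u, c) => _.
exists (fun i => phi (p i) + (if [set i]%SET \in t then 0 else 1)) => f fc j.
have /cellsP[ft fd] := fc; have [_ fA _] := tP f ft.
rewrite inE => /andP[fj Aj].
rewrite (@gapE _ _ _ _ gen_lin (L f)) //; last first.
  move=> i fi; rewrite -(LP f ft _ (hull_vertex p fi)) ifT ?addr0 //.
  by apply: (t_down f); rewrite ?sub1set // -card_gt0 cards1.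
have jA : hull p A (p j) by exact: hull_vertex.
have phi_ge := convex_above_cell phi_cvx fA fd (LP f ft).
rewrite subr_gt0; case: ifPn => jt; last by rewrite ltr_pwDr ?phi_ge.
rewrite addr0 lt_neqAle phi_ge // andbT; apply/eqP => phi_j.
have [b fb [b_avoid]] := generic_segment gen_lin (fun g => L g - L f) tA fA fd.
move=> /(_ _ jA)[g gc [gj [s s01 gy]]]; have /cellsP[gt gd] := gc.
have s0 : 0 < s by case/andP: s01.
have bA := hull_sub fA fb.
have jg : j \in g.
  have /hullP[w [wj w1 _] _] := tI _ _ jt gt _ (hull_vertex p (set11 j)) gj.
  apply: contraT => gj'; move: w1; rewrite big1 => [/eqP|i _].
    by rewrite eq_sym oner_eq0.
  by apply: wj; rewrite !inE; apply: contraNN gj' => /andP[/eqP <-].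
have fg : f != g by apply: contraNneq fj => ->.
have y_eq : affine_fun (L g) ((1 - s) *: p j + s *: b) = affine_fun (L f) ((1 - s) *: p j + s *: b).
  apply/le_anti; rewrite -(LP g gt _ gy) phi_ge ?andbT; last first.
    by apply: hull_line => //; case/andP: s01 => /ltW -> /ltW ->.
  rewrite affine_fun_line phi_j -(LP f ft _ fb).
  by move/convex_hullP: phi_cvx; exact.
have Lb : affine_fun (L g - L f) b = 0.
  have := y_eq; rewrite !affine_fun_line phi_j -(LP g gt _ gj) => /addrI.
  by rewrite affine_funB => /(mulfI (lt0r_neq0 s0)) ->; rewrite subrr.
have Lf : {in f, forall i, affine_fun (L g - L f) (p i) = 0}.
  move=> i fi; apply/eqP; apply: contraT => Li.
  have := b_avoid g; rewrite Lb eqxx => H; suff : false by [].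
  by apply: H; exists i.
case: (phi_max f g); [exact: cell_maximal|exact: cell_maximal|exact: fg|].
exists (L g).1, (L g).2; split; last exact: LP.
move=> v fv; rewrite (LP f ft _ fv).
have /hullP[w wv _] := fv; have := affine_fun_barycentric (L g - L f) wv.
rewrite big1 => [|i _]; last first.
  by case: wv => wf _ _; have [/Lf ->|/wf ->] := boolP (i \in f); rewrite ?mulr0 ?mul0r.
by rewrite affine_funB => /eqP; rewrite subr_eq0 => /eqP <-.
Qed.

Variable h : I -> R.
Hypotheses (t_sub : forall f, f \in t -> f != set0 /\ f \subset A)
  (t_down : forall f g, f \in t -> g != set0 -> g \subset f -> g \in t)
  (t_pure : forall f, f \in t -> exists2 g, g \in cells d t & f \subset g)
  (t_cov : covers p A t)
  (t_supp : {in cells d t, forall f, supports p h A f}).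

Lemma supported_triangulation : triangulation p A t.
Proof.
split=> //.
- move=> f ft; have [f_neq0 fA] := t_sub ft; split=> //.
  by have [g /cellsP[_ gd]] := t_pure ft; exact: sub_cell_independent.
- move=> f g ft gt v /hullP[b bv b0] /hullP[c cv c0].
  have [f' f'c ff'] := t_pure ft; have [g' g'c gg'] := t_pure gt.
  have up (u u' : {set I}) x : u \subset u' -> barycentric p u x v -> barycentric p u' x v.
    move=> /subsetP uu' [xu x1 xv]; split=> // i u'i; apply: xu.
    by apply: contra u'i; exact: uu'.
  have /cellsP[f't f'd] := f'c; have /cellsP[g't g'd] := g'c.
  have bc : b = c.
    apply: (supports_barycentric gen_lin f'd g'd (t_sub f't).2 (t_sub g't).2
      (t_supp f'c) (t_supp g'c)) => //.
    - exact: up bv.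
    - exact: up cv.
  by apply/hullP; exists b => //; apply: barycentricI; rewrite // bc.
- by move=> v; split=> [/t_cov//|[f /t_sub[_ fA]]]; exact: hull_sub.
Qed.

(** The convex function is the maximum of the affine functions of the cells,
    which on a given cell is attained by its own affine function. *)
Lemma regular_of_heights : is_regular p A t.
Proof.
split; first exact: supported_triangulation.
have /fin_all_exists[L LP] : forall f : {set I}, exists l, #|f| = d.+1 ->
    {in f, forall i, affine_fun l (p i) = h i}.
  move=> f; have [/(interpolation gen_lin h)[l lf]|] := eqVneq #|f| d.+1.
    by exists l.
  by move=> fd; exists 0 => fd'; rewrite fd' eqxx in fd.
have L_le f g v : f \in cells d t -> g \in cells d t -> hull p g v ->
    affine_fun (L f) v <= affine_fun (L g) v.
  move=> fc gc /hullP[w wv w0]; rewrite !(affine_fun_barycentric _ wv).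
  have /cellsP[ft fd] := fc; have /cellsP[gt gd] := gc.
  apply: ler_sum => i _; case: wv => wg _ _.
  have [gi|/wg ->] := boolP (i \in g); last by rewrite !mul0r.
  rewrite ler_wpM2l // (LP g gd _ gi).
  have [/(LP f fd) ->//|fi] := boolP (i \in f).
  rewrite -subr_ge0 -(gapE gen_lin _ fd (LP f fd)) ltW // t_supp // inE fi.
  exact: (subsetP (t_sub gt).2).
have t_cov_cells v : hull p A v -> exists2 g, g \in cells d t & hull p g v.
  by move=> /t_cov[f /t_pure[g gc fg] fv]; exists g => //; exact: hull_sub fv.
pose cell_at v := epsilon (inhabits set0) (fun g => g \in cells d t /\ hull p g v).
pose phi v := affine_fun (L (cell_at v)) v.
have phiE g v : g \in cells d t -> hull p g v -> phi v = affine_fun (L g) v.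
  move=> gc gv; rewrite /phi.
  have [|cc cv] := @epsilon_spec _ (inhabits set0) (fun g => g \in cells d t /\ hull p g v).
    by exists g.
  by apply/le_anti; rewrite !L_le.
exists phi; split.
- apply/convex_hullP => v v' s vA v'A s01.
  have [g gc gy] : exists2 g, g \in cells d t & hull p g ((1 - s) *: v + s *: v').
    by apply/t_cov_cells/hull_line => //; case/andP: s01 => /ltW -> /ltW ->.
  have [k kc kv] := t_cov_cells v vA; have [k' kc' kv'] := t_cov_cells v' v'A.
  case/andP: s01 => s0 s1.
  rewrite (phiE g) // (phiE k v) // (phiE k' v') // affine_fun_line.
  by rewrite lerD // ler_wpM2l ?L_le ?subr_ge0 // ltW.
- move=> f ft; have [g gc fg] := t_pure ft.
  by exists (L g).1, (L g).2 => v fv; apply: (phiE g) => //; exact: hull_sub fv.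
move=> f g /maxsetP[ft fmax] /maxsetP[gt gmax] fg [u [c [ucf ucg]]].
have maxc (k : {set I}) : k \in t ->
    (forall k', k' \in t -> k \subset k' -> k' = k) -> k \in cells d t.
  move=> kt kmax; have [k' k'c kk'] := t_pure kt.
  by rewrite -(kmax k') //; case/cellsP: k'c.
have fc := maxc f ft fmax; have gc := maxc g gt gmax.
have /cellsP[_ fd] := fc; have /cellsP[_ gd] := gc.
have [j gj fj] : exists2 j, j \in g & j \notin f.
  by apply/subsetPn; apply: contra fg => gf; rewrite eq_sym eqEcard gf fd gd leqnn.
have uch (k : {set I}) : k \in cells d t -> coincides_affine p phi k u c ->
    {in k, forall i, affine_fun (u, c) (p i) = h i}.
  move=> kc uck i ki; have /cellsP[_ kd] := kc.
  have ki_hull := hull_vertex p ki; by rewrite -[LHS]uck // (phiE k) // (LP k).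
have : 0 < gap p f h j by rewrite t_supp // inE fj (subsetP (t_sub gt).2).
by rewrite (gapE gen_lin _ fd (uch f fc ucf)) (uch g gc ucg) // subrr ltxx.
Qed.

End HeightsOfRegular.
End Regularity.

(** * Flips *)

Section Flips.
Local Open Scope classical_set_scope.
Local Open Scope ring_scope.
Variables (R : realType) (d : nat) (I : finType) (p : I -> 'rV[R]_d).
Implicit Types (P f g : {set I}) (v : 'rV[R]_d).
Hypothesis gen_lin : forall f, #|f| = d.+1 -> ~ on_hyperplane p f.

Lemma near_gap_gt0 f (h k : I -> R) j : 0 < gap p f h j ->
  \forall s \near 0^'+, 0 < gap p f (fun i => h i + s * k i) j.
Proof.
move=> /(near0_line_gt0 (gap p f k j)); apply: filterS => s.
have -> : (fun i => h i + s * k i) = (fun i => 1 * h i + s * k i).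
  by apply/funext => i; rewrite mul1r.
by rewrite gap_linear mul1r.
Qed.

Variables (A T : {set I}) (t : {set {set I}}) (w : I -> R).
Hypotheses (tA : triangulation p A t) (wT : circuit p T w) (TA : T \subset A)
  (Ht : half T (positive_part w) \subset t).

Let P := positive_part w.
Let N := positive_part (fun i => - w i).
Let t' := replace_subcomplex t (half T P) (half T N).
Let wN : circuit p T (fun i => - w i) := circuit_opp wT.
Let Td : #|T| = d.+2. Proof. by case: wT. Qed.
Let PT : P \subset T := pos_sub wT.
Let NT : N \subset T := pos_sub wN.

Lemma half_down f g : f \in half T P -> g != set0 -> g \subset f -> g \in half T P.
Proof. by have [_ + _ _] := half_triangulation gen_lin wT; apply. Qed.

(** The two triangulations of [T] overlap, so a triangulation containing one
    of them has no cell of the other. *)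
Lemma opposite_cell_notin j : w j < 0 -> T :\ j \notin t.
Proof.
move=> wj; apply/negP => jt.
have Tj : j \in T by rewrite (subsetP NT) // inE oppr_gt0.
have Tjd := card_setD1_circuit Td Tj.
have Tj0 : T :\ j != set0 by rewrite -card_gt0 Tjd.
have [b [v [bv b0 bj]]] := barycenter p Tj0.
have vj : hull p (T :\ j) v by apply/hullP; exists b.
have [i wi vi] := hull_circuit wT (hull_sub (subsetDl T [set j]%SET) vj).
have Pi : i \in P by rewrite inE.
have it : T :\ i \in t by rewrite (subsetP Ht) // (setD1_half PT Td) // (subsetP PT).
have [tP _ tI _] := tA; have [_ _ j_ind] := tP _ jt.
have /hullP[c cv _] := tI _ _ jt it v vj vi.
have cvj : barycentric p (T :\ j) c v.
  by case: cv => c0 c1 cc; split=> // k kj; rewrite c0 // inE (negbTE kj).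
have ij : i != j by apply: contraTneq wi => ->; rewrite -leNgt ltW.
have : 0 < b i by rewrite bj // !inE ij (subsetP PT).
rewrite (independent_barycentric_uniq j_ind bv cvj); case: cv => -> //; rewrite ?ltxx //.
by rewrite !inE eqxx andbF.
Qed.

Section Regular.
Variables (f0 : {set I}) (h k : I -> R).
Hypotheses (f0A : f0 \subset A) (fd0 : #|f0| = d.+1).
Hypothesis h_weak : {in cells d t, forall f, {in A :\: f, forall j,
  0 <= gap p f h j /\ (gap p f h j = 0 -> j |: f = T)}}.
Hypotheses (wh : \sum_i w i * h i = 0) (wk : \sum_i w i * k i < 0).

Let t_sub f : f \in t -> f != set0 /\ f \subset A.
Proof. by case: tA => tP _ _ _ /tP[]. Qed.

(* The zero gaps allowed by [h_weak] only occur at the cells being flipped. *)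
Let cell_pos f j : f \in cells d t -> f \notin half T P -> j \in A :\: f ->
  0 < gap p f h j.
Proof.
move=> fc fH jf; have [gap0 gapT] := h_weak fc jf; have /cellsP[ft _] := fc.
rewrite lt_neqAle gap0 andbT eq_sym; apply/eqP => /gapT jfT.
have fE : f = T :\ j by rewrite -jfT setU1K //; case/setDP: jf.
have Tj : j \in T by rewrite -jfT setU11.
have : ~~ (0 < w j) by apply: contra fH => wj; rewrite fE (setD1_half PT Td Tj) inE.
rewrite -leNgt le_eqVlt -[w j == 0]negbK -(circuit_mem _ wT) Tj /= => wj.
by have := opposite_cell_notin wj; rewrite -fE ft.
Qed.

Let half_pos j i : j \in T -> i \in A -> i \notin T -> 0 < gap p (T :\ j) h i.
Proof.
move=> Tj Ai iT; have [m wm] := circuit_pos_ex wT.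
have Pm : m \in P by rewrite inE.
have Tm : m \in T := subsetP PT _ Pm.
have mc : T :\ m \in cells d t.
  by apply/cellsP; rewrite (card_setD1_circuit Td Tm) (subsetP Ht) ?(setD1_half PT Td).
have im : i \in A :\: (T :\ m) by rewrite !inE (negbTE iT) andbF.
have [gap0 gapT] := h_weak mc im.
have {gapT} gap_m : 0 < gap p (T :\ m) h i.
  rewrite lt_neqAle gap0 andbT eq_sym; apply/eqP => /gapT iTE.
  by move: iT; rewrite -iTE setU11.
by rewrite (gap_coplanar gen_lin i wT wh Tj Tm).
Qed.

Lemma flip_supports :
  \forall s \near 0^'+, {in cells d t', forall f, supports p (fun i => h i + s * k i) A f}.
Proof.
have near_fj (fj : {set I} * I) : \forall s \near 0^'+,
    fj.1 \in cells d t' -> fj.2 \in A :\: fj.1 -> 0 < gap p fj.1 (fun i => h i + s * k i) fj.2.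
  case: fj => f j /=; have [jf|] := boolP (j \in A :\: f); last by move=> _; near=> s.
  have [fc|] := boolP (f \in cells d t'); last by move=> _; near=> s.
  have near_pos : 0 < gap p f h j -> \forall s \near 0^'+,
      true -> true -> 0 < gap p f (fun i => h i + s * k i) j.
    by move/(near_gap_gt0 k); apply: filterS.
  have /cellsP[+ fd] := fc; rewrite inE => /orP[/setDP[ft fH]|fN].
    by apply/near_pos/cell_pos => //; apply/cellsP.
  have [m Nm fE] := half_cell NT Td fd fN.
  have Tm : m \in T := subsetP NT _ Nm.
  have wm : w m < 0 by move: Nm; rewrite inE oppr_gt0.
  have [jm|jm] := eqVneq j m; last first.
    apply: near_pos; rewrite fE; move: jf; rewrite fE !inE jm /= => /andP[jT Aj].
    exact: half_pos.
  near=> s; move=> _ _; have s0 : 0 < s by near: s; exact: nbhs_right_gt.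
  rewrite fE jm -(nmulr_rlt0 _ wm) -(circuit_gap gen_lin _ wT Tm).
  under eq_bigr => i _ do rewrite mulrDr mulrCA.
  by rewrite big_split /= wh add0r -mulr_sumr pmulr_rlt0.
have : \forall s \near 0^'+, forall fj : {set I} * I, fj.1 \in cells d t' ->
    fj.2 \in A :\: fj.1 -> 0 < gap p fj.1 (fun i => h i + s * k i) fj.2.
  exact: filter_forall.
by apply: filterS => s s_gap f fc j; exact: (s_gap (f, j)).
Unshelve. all: by end_near. Qed.

Lemma flip_covers : covers p A t'.
Proof.
have [_ _ _ tcov] := tA.
move=> v /tcov[f ft fv]; have [fH|fH] := boolP (f \in half T P); last first.
  by exists f => //; rewrite inE inE fH ft.
have [i wi vi] : exists2 i, 0 < - w i & hull p (T :\ i) v.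
  by apply: (hull_circuit wN); move: fH fv; rewrite inE => /and3P[_ fT _]; exact: hull_sub.
have Ni : i \in N by rewrite inE.
by exists (T :\ i) => //; rewrite inE (setD1_half NT Td) ?Ni ?orbT // (subsetP NT).
Qed.

Lemma flip_pure f : f \in t' -> exists2 g, g \in cells d t' & f \subset g.
Proof.
rewrite inE => /orP[/setDP[ft fH]|fN].
  have [g /cellsP[gt gd] fg] := triangulation_pure gen_lin tA f0A fd0 ft.
  exists g => //; apply/cellsP; split=> //; rewrite inE inE gt andbT.
  by rewrite (contra _ fH) // => gH; apply: half_down gH _ fg; case: (t_sub ft).
have [i Ni fTi] := half_setD1 NT fN; exists (T :\ i) => //.
have Ti := subsetP NT _ Ni.
by apply/cellsP; rewrite (card_setD1_circuit Td Ti) inE (setD1_half NT Td) ?Ni ?orbT.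
Qed.

(** The delicate case is a face [g] of the removed complex contained in a
    remaining simplex; it must not contain all the negative vertices.  If it
    did, a cell of [t] around that simplex would contain them too, so all the
    vertices of [T] strictly above the hyperplane of this cell would have
    positive coefficients, and [\sum_i w i * h i] could not vanish. *)
Lemma flip_down f g : f \in t' -> g != set0 -> g \subset f -> g \in t'.
Proof.
move=> ft' g0 gf; have /setUP[/setDP[ft fH]|fN] := ft'; last first.
  rewrite inE; have [_ down _ _] := half_triangulation gen_lin wN.
  by rewrite (down f g) ?orbT.
have [_ t_down _ _] := tA; have gt := t_down f g ft g0 gf.
rewrite inE inE gt andbT; have [gH /=|//] := boolP (g \in half T P).
have gT : g \subset T by move: gH; rewrite inE => /and3P[].
rewrite inE g0 gT /=; apply/negP => Ng.
have [f' f'c ff'] := triangulation_pure gen_lin tA f0A fd0 ft.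
have /cellsP[f't f'd] := f'c.
have f'H : f' \notin half T P.
  by apply: contra fH => f'H; apply: half_down f'H _ ff'; case: (t_sub ft).
have [l lf'] := interpolation gen_lin h f'd.
have wl : \sum_i w i * (h i - affine_fun l (p i)) = 0.
  under eq_bigr => i _ do rewrite mulrBr.
  by rewrite sumrB wh (affine_fun_circuit l wT) subrr.
have [i Ti f'i] : exists2 i, i \in T & i \notin f'.
  by apply/subsetPn; apply/negP => /subset_leq_card; rewrite Td f'd ltnn.
have out_pos j : j \in T -> j \notin f' -> 0 < w j * (h j - affine_fun l (p j)).
  move=> Tj f'j; rewrite -(gapE gen_lin _ f'd lf') mulr_gt0 ?cell_pos //.
    rewrite lt_neqAle eq_sym -(circuit_mem _ wT) Tj /= leNgt -oppr_gt0.
    apply: contra f'j => wj; apply/(subsetP ff')/(subsetP gf)/(subsetP Ng).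
    by rewrite inE.
  by rewrite inE f'j (subsetP TA).
have : \sum_i w i * (h i - affine_fun l (p i)) == 0 by rewrite wl.
rewrite psumr_eq0 => [/allP/(_ i)|j _].
  by rewrite mem_index_enum (gt_eqF (out_pos i Ti f'i)) => /(_ isT).
have [/lf' ->|f'j] := boolP (j \in f'); first by rewrite subrr mulr0.
have [Tj|] := boolP (j \in T); first by rewrite ltW // out_pos.
by rewrite (circuit_mem _ wT) negbK => /eqP ->; rewrite mul0r.
Qed.

(** The flipped complex consists of lower faces for heights slightly beyond the
    critical ones, in a direction [k] making the circuit negative. *)
Lemma flip_regular : is_regular p A t'.
Proof.
near ((0 : R)^'+) => s.
apply: (@regular_of_heights _ _ _ _ gen_lin A t' (fun i => h i + s * k i)).
- move=> f; rewrite inE => /orP[/setDP[/t_sub //]|].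
  by rewrite inE => /and3P[f_neq0 fT _]; split=> //; exact: subset_trans TA.
- exact: flip_down.
- exact: flip_pure.
- exact: flip_covers.
- by near: s; exact: flip_supports.
Unshelve. all: by end_near. Qed.

End Regular.

Lemma flip_Vr : exists2 kappa, 0 < kappa &
  Vr p t' - Vr p t = kappa * \sum_i w i * sqnorm (p i).
Proof.
have [kappa k0 kE] := Vr_half gen_lin wT; exists kappa; rewrite // -kE.
have VrE u : Vr p u = \sum_(s in cells d u) (\sum_(i in s) sqnorm (p i)) * vol p s.
  by apply: eq_bigl => s; rewrite inE.
rewrite !VrE (big_setID (cells d (half T N))) /= [X in _ - X](big_setID (cells d (half T P))) /=.
have -> : cells d t' :&: cells d (half T N) = cells d (half T N).
  apply/setIidPr/subsetP => s /cellsP[sN sd].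
  by apply/cellsP; rewrite inE sN orbT.
have -> : cells d t :&: cells d (half T P) = cells d (half T P).
  apply/setIidPr/subsetP => s /cellsP[sN sd].
  by apply/cellsP; rewrite (subsetP Ht).
have -> : cells d t' :\: cells d (half T N) = cells d t :\: cells d (half T P).
  apply/setP => s; rewrite !inE; have [sd|_] := eqVneq #|s| d.+1; last by rewrite !andbF.
  rewrite !andbT; set in_half := [&& _, _ & ~~ (N \subset s)].
  have [sH|_] := boolP in_half; last by rewrite orbF.
  have sN : s \in half T N by rewrite inE.
  have [m Nm ->] := half_cell NT Td sd sN.
  rewrite (negbTE (opposite_cell_notin _)) ?andbF //.
  by move: Nm; rewrite inE oppr_gt0.
by rewrite opprD addrACA subrr addr0.
Qed.

End Flips.

(** * Delaunay triangulations *)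

Section Delaunay.
Local Open Scope classical_set_scope.
Local Open Scope ring_scope.
Variables (R : realType) (d : nat) (I : finType) (p : I -> 'rV[R]_d).
Implicit Types (f g : {set I}) (t : {set {set I}}) (v z : 'rV[R]_d) (h : I -> R).
Hypothesis p_gen : general_position p.

Let gen_lin f : #|f| = d.+1 -> ~ on_hyperplane p f.
Proof. by case: p_gen => _ H _; exact: H. Qed.

Let paraboloid i : R := sqnorm (p i).

(** The power of a point with respect to a sphere is the height of its lift to
    the paraboloid above a hyperplane. *)
Lemma sqnorm_sphere z (rho : R) v :
  sqnorm (v - z) - rho = sqnorm v - affine_fun (2%:R *: z, rho - sqnorm z) v.
Proof.
have -> : sqnorm (v - z) = sqnorm v - dot (2%:R *: z) v + sqnorm z.
  rewrite /sqnorm /dot -sumrB -big_split; apply: eq_bigr => j _ /=.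
  by rewrite !mxE; ring.
by rewrite /affine_fun /=; ring.
Qed.

Lemma gap_sphere f z (rho : R) j : #|f| = d.+1 -> circumsphere p f z rho ->
  gap p f paraboloid j = sqnorm (p j - z) - rho.
Proof.
move=> fd fz; rewrite sqnorm_sphere; apply: (gapE gen_lin) => // i /fz zi.
by apply/eqP; rewrite eq_sym -subr_eq0 -sqnorm_sphere zi subrr.
Qed.

Lemma circumsphere_ex f : #|f| = d.+1 -> exists z rho, circumsphere p f z rho.
Proof.
move=> fd; have [l lf] := interpolation gen_lin paraboloid fd.
pose z := 2%:R^-1 *: l.1; exists z, (l.2 + sqnorm z) => i /lf li.
apply/eqP; rewrite -subr_eq0 sqnorm_sphere addrK scalerA divff ?scale1r ?pnatr_eq0 //.
by rewrite -surjective_pairing li subrr.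
Qed.

Lemma gap_paraboloid_neq0 f j : #|f| = d.+1 -> j \notin f -> gap p f paraboloid j != 0.
Proof.
move=> fd fj; have [z [rho fz]] := circumsphere_ex fd.
rewrite (gap_sphere _ fd fz) subr_eq0; apply/eqP => jz.
have [_ _ gen_sph] := p_gen; apply: (gen_sph (j |: f)); first by rewrite cardsU1 fj fd.
by exists z, rho => i /setU1P[->//|]; exact: fz.
Qed.

Section Triangulated.
Variables (A f0 : {set I}).
Hypotheses (f0A : f0 \subset A) (fd0 : #|f0| = d.+1).

(** Lifting to the paraboloid turns spheres into hyperplanes: a cell has an
    empty circumsphere when it is a lower face for the squared norm. *)
Lemma delaunay_of_supports t : triangulation p A t ->
  {in cells d t, forall f, supports p paraboloid A f} -> is_delaunay p A t.
Proof.
move=> tA supp; have [tP _ _ _] := tA; split=> // s sA [sd s_ind]; split=> [st|].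
  have [z [rho sz]] := circumsphere_ex sd; exists z, rho; split=> // i Ai.
  have [/sz ->//|si] := boolP (i \in s).
  rewrite -subr_ge0 -(gap_sphere _ sd sz); apply/ltW/supp; first exact/cellsP.
  by rewrite inE si.
move=> [z [rho [sz z_empty]]].
have cov := triangulation_covers gen_lin tA f0A fd0.
apply: (supports_mem gen_lin cov _ sA sd (h := paraboloid)).
  by move=> g gc; split; [case/cellsP: gc => /tP[]|exact: supp].
move=> j; rewrite inE => /andP[sj Aj].
by rewrite lt_neqAle eq_sym gap_paraboloid_neq0 // (gap_sphere _ sd sz) subr_ge0 z_empty.
Qed.

(** If the inequality fails, the gaps of two different (d+2)-sets, which are
    affine along the segment from [h] to the paraboloid, vanish at the same
    time. *)
Definition generic_heights h : Prop :=
  forall f g i j, #|f| = d.+1 -> #|g| = d.+1 -> i \notin f -> j \notin g ->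
    i |: f != j |: g ->
    gap p f h i * gap p g paraboloid j != gap p f paraboloid i * gap p g h j.

(** Each condition is a linear inequation on the heights.  It is not trivial
    since one of the two circuits has a vertex [m] outside the other one. *)
Lemma generic_heights_ex t h : {in cells d t, forall f, supports p h A f} ->
  exists2 h', {in cells d t, forall f, supports p h' A f} & generic_heights h'.
Proof.
move=> supp.
pose L (x : {set I} * I * ({set I} * I)) m :=
  gap_coef p x.1.1 x.1.2 m * gap p x.2.1 paraboloid x.2.2 -
  gap p x.1.1 paraboloid x.1.2 * gap_coef p x.2.1 x.2.2 m.
have LE x (k : I -> R) : \sum_m L x m * k m =
    gap p x.1.1 k x.1.2 * gap p x.2.1 paraboloid x.2.2 -
    gap p x.1.1 paraboloid x.1.2 * gap p x.2.1 k x.2.2.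
  under eq_bigr => m _ do rewrite mulrBl.
  rewrite sumrB !(gap_coefE p _ k) mulr_suml mulr_sumr; congr (_ - _).
    by apply: eq_bigr => m _; rewrite mulrAC.
  by apply: eq_bigr => m _; rewrite mulrA.
have [eta _ eta_avoid] := positive_avoiding_zeros L.
have near_supp (fj : {set I} * I) : \forall s \near 0^'+,
    fj.1 \in cells d t -> fj.2 \in A :\: fj.1 ->
    0 < gap p fj.1 (fun i => h i + s * eta i) fj.2.
  have [fc|] := boolP (fj.1 \in cells d t); last by move=> _; near=> s.
  have [jf|] := boolP (fj.2 \in A :\: fj.1); last by move=> _; near=> s.
  by apply: filterS (near_gap_gt0 eta (supp _ fc _ jf)).
have near_gen x : \forall s \near 0^'+, (exists m, L x m != 0) ->
    \sum_m L x m * (h m + s * eta m) != 0.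
  have [Lx|Lx] := pselect (exists m, L x m != 0); last by near=> s.
  have := @near0_line_neq0 R (\sum_m L x m * h m) (\sum_m L x m * eta m).
  rewrite eta_avoid // orbT => /(_ isT); apply: filterS => s + _.
  rewrite mulr_sumr -big_split /=; congr (_ != _); apply: eq_bigr => m _.
  by rewrite mulrDr mulrCA.
near ((0 : R)^'+) => s.
exists (fun i => h i + s * eta i).
  move=> f fc j jf.
  have H : forall fj : {set I} * I, fj.1 \in cells d t -> fj.2 \in A :\: fj.1 ->
      0 < gap p fj.1 (fun i => h i + s * eta i) fj.2.
    by near: s; exact: filter_forall.
  exact: (H (f, j)).
move=> f g i j fd gd fi gj ij.
have H : forall x, (exists m, L x m != 0) -> \sum_m L x m * (h m + s * eta m) != 0.
  by near: s; exact: filter_forall.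
have := H (f, i, (g, j)); rewrite LE /= subr_eq0; apply.
have [m mf mg] : exists2 m, m \in i |: f & m \notin j |: g.
  apply/subsetPn; apply: contra ij => sub; rewrite eqEcard sub.
  by rewrite !cardsU1 fi gj fd gd leqnn.
exists m; rewrite /L /=.
have gc := gap_coef_circuit gen_lin gd gj; have fc := gap_coef_circuit gen_lin fd fi.
have -> : gap_coef p g j m = 0 by case: gc => _ [-> //].
by rewrite mulr0 subr0 mulf_neq0 ?gap_paraboloid_neq0 // -(circuit_mem _ fc).
Unshelve. all: by end_near. Qed.

(** Push the heights [h] of a regular triangulation towards the paraboloid.
    Either all cells stay lower faces up to the end, and the triangulation is
    Delaunay, or some circuit degenerates first; by genericity it is the only
    one at that time, and passing it is a flip that lowers the functional. *)
Lemma regular_flip_or_delaunay t : is_regular p A t ->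
  is_delaunay p A t \/ exists t', nonoptimal_flip p A t t'.
Proof.
move=> t_reg; have [tA _] := t_reg; have [tP t_down _ _] := tA.
have [h0 supp0] := heights_of_regular gen_lin t_reg.
have [h supp h_gen] := generic_heights_ex supp0.
pose q := paraboloid.
pose bad (x : {set I} * I) :=
  [&& x.1 \in cells d t, x.2 \in A :\: x.1 & gap p x.1 q x.2 < 0].
have [/existsP[x0 bad0]|/existsPn no_bad] := boolP [exists x, bad x]; last first.
  left; apply: delaunay_of_supports => // f fc j jf.
  have := no_bad (f, j); rewrite /bad /= fc jf /= -leNgt le_eqVlt eq_sym.
  by case/cellsP: fc => _ fd; case/setDP: jf => _ fj; rewrite (negbTE (gap_paraboloid_neq0 fd fj)).
right.
(* The parameter at which the gap of a bad pair vanishes on the way from [h] to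
   [q]; the first such time is the critical one. *)
pose time (x : {set I} * I) := gap p x.1 h x.2 / (gap p x.1 h x.2 - gap p x.1 q x.2).
case: (@Order.TotalTheory.arg_minP _ _ _ x0 bad time bad0) => -[f1 j1] /and3P[/= f1c j1f q1] time_min.
have h1 : 0 < gap p f1 h j1 by exact: supp.
set s := time (f1, j1) in time_min.
have s0 : 0 < s by rewrite divr_gt0 //= subr_gt0 (lt_trans q1).
have s1 : s < 1 by rewrite ltr_pdivrMr /= ?subr_gt0 ?(lt_trans q1) // mul1r ltrDl oppr_gt0.
pose hs i := (1 - s) * h i + s * q i.
have gap_hs f j : gap p f hs j = (1 - s) * gap p f h j + s * gap p f q j by exact: gap_linear.
have gap_ge0 f j : f \in cells d t -> j \in A :\: f -> 0 <= gap p f hs j.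
  move=> fc jf; have hf := supp f fc j jf; rewrite gap_hs.
  have [qf|qf] := leP 0 (gap p f q j); last first.
    have := time_min (f, j); rewrite /bad /= fc jf qf => /(_ isT).
    by rewrite ler_pdivlMr /= ?subr_gt0 ?(lt_trans qf) //; lra.
  by rewrite addr_ge0 // mulr_ge0 ?(ltW s0) ?(ltW hf) // subr_ge0 ltW.
have gap1 : gap p f1 hs j1 = 0.
  have neq0 : gap p f1 h j1 - gap p f1 q j1 != 0.
    by rewrite gt_eqF // subr_gt0 (lt_trans q1).
  have sE : s * (gap p f1 h j1 - gap p f1 q j1) = gap p f1 h j1 by rewrite divfK.
  by rewrite gap_hs; lra.
have /cellsP[f1t f1d] := f1c; have /setDP[Aj1 f1j1] := j1f.
pose T := j1 |: f1; pose w := gap_coef p f1 j1.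
have wT : circuit p T w by exact: gap_coef_circuit.
have Td : #|T| = d.+2 by case: wT.
have [_ f1A _] := tP _ f1t.
have TA : T \subset A by rewrite subUset sub1set Aj1.
have wE (k : I -> R) : \sum_i w i * k i = gap p f1 k j1 by rewrite gap_coefE.
have whs : \sum_i w i * hs i = 0 by rewrite wE.
have f1E : T :\ j1 = f1 by rewrite setU1K.
have gap_eq0 f j : f \in cells d t -> j \in A :\: f -> gap p f hs j = 0 -> j |: f = T.
  move=> fc jf; rewrite gap_hs => gap0; have /cellsP[_ fd] := fc; have /setDP[_ fj] := jf.
  apply/eqP; apply: contraT => /(h_gen f f1 j j1 fd f1d fj f1j1)/eqP[].
  have ns0 : 1 - s != 0 by rewrite gt_eqF // subr_gt0.
  apply: (mulfI ns0); rewrite !mulrA [(1 - s) * gap p f paraboloid j]mulrC -[RHS]mulrA.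
  move: gap0 gap1; rewrite gap_hs => /eqP; rewrite addr_eq0 => /eqP -> /eqP.
  by rewrite addr_eq0 => /eqP ->; rewrite /q; ring.
pose k i := q i - h i.
have gap_k f j : gap p f k j = gap p f q j - gap p f h j.
  rewrite -[RHS]addrC -mulN1r -[X in _ + X]mul1r -gap_linear; congr gap.
  by apply/funext => i; rewrite /k mulN1r mul1r addrC.
have wk : \sum_i w i * k i < 0 by rewrite wE gap_k subr_lt0 (lt_trans q1).
(* Just before the critical time the cells of [t] are still lower faces, and
   so are the cells of one triangulation of [T]. *)
have Ht : half T (positive_part w) \subset t.
  have half_t i : 0 < w i -> T :\ i \in t.
    move=> wi; have Ti : i \in T by rewrite (circuit_mem _ wT) gt_eqF.
    have Tj1 : j1 \in T by rewrite setU11.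
    have Tid := card_setD1_circuit Td Ti.
    have cov := triangulation_covers gen_lin tA f0A fd0.
    have near_T j : \forall e \near 0^'+, j \in A :\: (T :\ i) ->
        0 < gap p (T :\ i) (fun m => hs m + e * (- k m)) j.
      have [jTi|] := boolP (j \in A :\: (T :\ i)); last by move=> _; near=> e.
      have [ji|ji] := eqVneq j i.
        near=> e; move=> _; have e0 : 0 < e by near: e; exact: nbhs_right_gt.
        rewrite ji -(pmulr_rgt0 _ wi) -(circuit_gap gen_lin _ wT Ti).
        under eq_bigr => m _ do rewrite mulrDr mulrCA mulrN.
        by rewrite big_split /= whs add0r -mulr_sumr sumrN pmulr_rgt0 // oppr_gt0.
      have [Aj Tj] : j \in A /\ j \notin T.
        by move: jTi; rewrite !inE ji /= => /andP[].
      suff gap_gt0 : 0 < gap p (T :\ i) hs j.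
        by apply: filterS (near_gap_gt0 (fun m => - k m) gap_gt0).
      rewrite (gap_coplanar gen_lin j wT whs Ti Tj1) f1E.
      have jf1 : j \in A :\: f1 by rewrite inE Aj andbT; apply: contra Tj; exact: setU1r.
      rewrite lt_neqAle gap_ge0 // andbT eq_sym; apply/eqP => /(gap_eq0 _ _ f1c jf1) TE.
      by move: Tj; rewrite -TE setU11.
    near ((0 : R)^'+) => e.
    have e0 : 0 < e by near: e; exact: nbhs_right_gt.
    have es : e < s by near: e; exact: nbhs_right_lt.
    apply: (supports_mem gen_lin cov _ _ Tid (h := fun m => hs m + e * (- k m))).
    - move=> g gc; have /cellsP[gt gd] := gc; split; first by case: (tP _ gt).
      move=> j jg; have gh := supp g gc j jg.
      have -> : (fun m => hs m + e * - k m) = (fun m => (1 - (s - e)) * h m + (s - e) * q m).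
        by apply/funext => m; rewrite /hs /k; ring.
      rewrite gap_linear; have := gap_ge0 g j gc jg; rewrite gap_hs.
      have [qg|qg] := leP 0 (gap p g q j); last by nra.
      move=> _; rewrite ltr_pwDl //; first by rewrite mulr_gt0 //; lra.
      by rewrite mulr_ge0 // subr_ge0 ltW.
    - by apply: subset_trans TA; exact: subsetDl.
    - have H : forall j, j \in A :\: (T :\ i) -> 0 < gap p (T :\ i) (fun m => hs m + e * (- k m)) j.
        by near: e; exact: filter_forall.
      by move=> j; exact: H.
  apply/subsetP => f fH; have [i] := half_setD1 (pos_sub wT) fH.
  rewrite inE => /half_t it fTi; apply: (t_down _ f it) => //.
  by move: fH; rewrite inE => /and3P[].
exists (replace_subcomplex t (half T (positive_part w)) (half T (positive_part (fun i => - w i)))).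
exists (half T (positive_part w)); split.
- exact: flip_circuit.
- apply: (@flip_regular _ _ _ _ gen_lin A T t w tA wT TA Ht f0 hs k f0A fd0 _ whs wk).
  by move=> f fc j jf; split; [exact: gap_ge0|exact: gap_eq0].
have [kappa kappa0 VrE] := flip_Vr gen_lin tA wT Ht.
by rewrite -subr_lt0 VrE wE pmulr_rlt0.
Unshelve. all: by end_near. Qed.

End Triangulated.
End Delaunay.

(** * Insertion of a point *)

Section Insertion.
Variables (R : realType) (d : nat) (I : finType) (p : I -> 'rV[R]_d).
Implicit Types (A s f : {set I}) (t : {set {set I}}).
Hypothesis gen_lin : forall f, #|f| = d.+1 -> ~ on_hyperplane p f.

Lemma regular_same_hull A (A' : {set I}) t : A \subset A' -> hull p A = hull p A' ->
  is_regular p A t -> is_regular p A' t.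
Proof.
move=> AA' hullE [[tP t_down tI tcov] [phi [phi_cvx phi_aff phi_max]]].
split; last by exists phi; split; rewrite -?hullE.
split=> //; last by rewrite -hullE.
by move=> f /tP[f_neq0 fA f_ind]; split=> //; exact: subset_trans AA'.
Qed.

Lemma hull_setU1 A q : hull p A (p q) -> hull p A = hull p (q |: A).
Proof.
move=> /hullP[c [cA c1 cq] c0]; apply/funext => v; apply/propext; split.
  exact/hull_sub/subsetUr.
have [qA|qA] := boolP (q \in A).
  by apply: hull_sub; rewrite subUset sub1set qA /=.
move=> /hullP[w [wA w1 wv] w0]; apply/hullP.
exists (fun i => (if i == q then 0 else w i) + w q * c i); last first.
  by move=> i; rewrite addr_ge0 ?mulr_ge0 //; case: ifP.
split.
- move=> i iA; rewrite (cA i iA) mulr0 addr0; case: eqP => // /eqP iq.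
  by rewrite wA // !inE negb_or iq.
- rewrite big_split /= -mulr_sumr c1 mulr1 -w1 [RHS](bigD1 q) //= addrC.
  congr (_ + _); rewrite [RHS]big_mkcond /=; apply: eq_bigr => i _.
  by case: eqP.
rewrite -wv /combination [RHS](bigD1 q) //=.
under eq_bigr => i _ do rewrite scalerDl -scalerA.
rewrite big_split /= -scaler_sumr -/(combination p c) cq addrC; congr (_ + _).
rewrite [RHS]big_mkcond /=; apply: eq_bigr => i _.
by case: eqP; rewrite ?scale0r.
Qed.

(** Inserting a point into the cell containing it is the flip of the circuit
    whose only positive vertex is that point.  The critical height of the new
    point is the one on the hyperplane of the cell. *)
Lemma insert_point_regular A t s q : is_regular p A t -> q \notin A ->
    s \in t -> #|s| = d.+1 -> hull p s (p q) ->
  is_regular p (q |: A) (insert_point t s q).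
Proof.
move=> t_regA qA st sd sq; have [[tPA _ _ _] _] := t_regA.
have [_ sA _] := tPA s st; have q_hull := hull_sub sA sq.
have AA' : A \subset q |: A := subsetUr _ _.
have t_reg := regular_same_hull AA' (hull_setU1 q_hull) t_regA.
have [tA' _] := t_reg; have [_ t_down _ _] := tA'.
have sA' := subset_trans sA AA'.
have [h supp] := heights_of_regular gen_lin t_reg.
have qs : q \notin s by apply: contra qA; exact: (subsetP sA).
have qf f : f \in t -> q \notin f.
  by case/tPA => _ fA _; apply: contra qA; exact: (subsetP fA).
pose w := gap_coef p s q; have wT : circuit p (q |: s) w by exact: gap_coef_circuit.
have cP := coordP gen_lin (p q) sd.
have c0 i : i \in s -> 0 < coord p s (p q) i.
  move=> si; have /hullP[c cv c_ge0] := sq.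
  rewrite lt_neqAle (barycentric_uniq gen_lin sd cP cv) c_ge0 andbT eq_sym.
  rewrite -(barycentric_uniq gen_lin sd cP cv).
  have : i \in q |: s by rewrite inE si orbT.
  have iq : (i == q) = false by apply: contraNF qs => /eqP <-.
  by rewrite (circuit_mem _ wT) /w /gap_coef iq sub0r oppr_eq0.
have wq : w q = 1 by rewrite /w /gap_coef eqxx; case: cP => -> //; rewrite subr0.
have ws i : i \in s -> w i = - coord p s (p q) i.
  move=> si; have iq : (i == q) = false by apply: contraNF qs => /eqP <-.
  by rewrite /w /gap_coef iq sub0r.
have posE : positive_part w = [set q]%SET.
  apply/setP => i; rewrite !inE; have [->|iq] := eqVneq i q; first by rewrite wq ltr01.
  have [si|si] := boolP (i \in s); first by rewrite ws // oppr_gt0 ltNge (ltW (c0 i si)).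
  have -> : w i = 0 by case: wT => _ [-> //]; rewrite !inE negb_or iq.
  by rewrite ltxx.
have negE : positive_part (fun i => - w i) = s.
  apply/setP => i; rewrite !inE; have [si|si] := boolP (i \in s).
    by rewrite ws // opprK c0.
  have [->|iq] := eqVneq i q; first by rewrite wq oppr_gt0 ltr10.
  have -> : w i = 0 by case: wT => _ [-> //]; rewrite !inE negb_or iq.
  by rewrite oppr0 ltxx.
have facesE : faces s = half (q |: s) (positive_part w).
  apply/setP => f; rewrite posE !inE sub1set; congr (_ && _).
  apply/idP/andP => [fs|[fqs qf']].
    by rewrite (subset_trans fs (subsetUr _ _)); split=> //; apply: contra qs; exact: (subsetP fs).
  apply/subsetP => i fi; have := subsetP fqs i fi.
  by rewrite !inE; case: eqP fi qf' => // -> ->.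
have coneE : cone q s = half (q |: s) (positive_part (fun i => - w i)).
  apply/setP => f; rewrite negE inE; apply/bigcupP/and3P => [[i si]|[f0 fqs /subsetPn[i si fi]]].
    rewrite inE => /andP[f0 fi]; split=> //.
      by apply: (subset_trans fi); rewrite setUS // subsetDl.
    apply/subsetPn; exists i => //; apply: contra qs => /(subsetP fi).
    by rewrite !inE eqxx /= orbF => /eqP <-.
  exists i => //; rewrite inE f0; apply/subsetP => j fj; have := subsetP fqs j fj.
  by rewrite !inE; case: (eqVneq j i) fj fi => [-> ->|].
rewrite /insert_point facesE coneE.
pose at_q i : R := (i == q)%:R.
(* The height of [q] is lowered onto the hyperplane of [s], and the flip moves
   it below. *)
pose hs i := 1 * h i + - gap p s h q * at_q i.
have gap_at_q f j : f \in t -> #|f| = d.+1 -> gap p f at_q j = (j == q)%:R.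
  move=> ft fd; rewrite /gap /at_q big1 ?subr0 // => i _.
  case: eqP => [->|_]; last by rewrite mulr0.
  by case: (coordP gen_lin (p j) fd) => -> //; rewrite ?mul0r // qf.
have gap_hs f j : f \in t -> #|f| = d.+1 ->
    gap p f hs j = gap p f h j - gap p s h q * (j == q)%:R.
  by move=> ft fd; rewrite gap_linear mul1r gap_at_q // mulNr.
apply: (@flip_regular _ _ _ _ gen_lin (q |: A) (q |: s) t w tA' wT _ _ s hs
  (fun i => - at_q i) sA' sd).
- by rewrite setUS.
- rewrite -facesE; apply/subsetP => f; rewrite inE => /andP[f0 fs].
  exact: (t_down s).
- move=> f fc j jf; have /cellsP[ft fd] := fc; rewrite gap_hs //.
  have [jq|jq] := eqVneq j q; last first.
    rewrite mulr0 subr0; have gap0 := supp f fc j jf.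
    by split; [exact: ltW|move/eqP; rewrite gt_eqF].
  rewrite mulr1 jq.
  have [l lf] := interpolation gen_lin h fd.
  have -> : gap p f h q - gap p s h q =
      \sum_i coord p s (p q) i * (h i - affine_fun l (p i)).
    rewrite (gapE gen_lin _ fd lf) /gap (affine_fun_barycentric l cP).
    under [RHS]eq_bigr => i _ do rewrite mulrBr.
    by rewrite sumrB; ring.
  have term_gt0 i : i \in s -> i \notin f -> 0 < coord p s (p q) i * (h i - affine_fun l (p i)).
    move=> si fi; rewrite mulr_gt0 ?c0 // -(gapE gen_lin _ fd lf) supp //.
    by rewrite inE fi (subsetP sA').
  have term_ge0 i : 0 <= coord p s (p q) i * (h i - affine_fun l (p i)).
    have [fi|fi] := boolP (i \in f); first by rewrite lf // subrr mulr0.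
    have [si|si] := boolP (i \in s); first by rewrite ltW // term_gt0.
    by case: cP => -> //; rewrite mul0r.
  split; first by rewrite sumr_ge0.
  move/eqP; rewrite psumr_eq0 // => /allP all0; congr (q |: _).
  apply/eqP; rewrite eq_sym eqEcard sd fd leqnn andbT; apply/subsetP => i si.
  have := all0 i; rewrite mem_index_enum => /(_ isT); apply: contraTT => fi.
  by rewrite gt_eqF // term_gt0.
- by rewrite -gap_coefE gap_hs // eqxx mulr1 subrr.
- rewrite (bigD1 q) //= big1 ?addr0 => [|i /negbTE iq]; last by rewrite /at_q iq oppr0 mulr0.
  by rewrite wq /at_q eqxx mul1r ltrN10.
Qed.

Lemma simplex_regular s : #|s| = d.+1 -> is_regular p s (faces s).
Proof.
move=> sd; have s0 : s != set0 by rewrite -card_gt0 sd.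
have ss : s \in faces s by rewrite inE s0 subxx.
apply: (@regular_of_heights _ _ _ _ gen_lin s (faces s) (fun=> 0)).
- by move=> f; rewrite inE => /andP[].
- by move=> f g; rewrite !inE => /andP[_ fs] -> gf; exact: subset_trans fs.
- by move=> f; rewrite inE => /andP[_ fs]; exists s => //; exact/cellsP.
- by move=> v sv; exists s.
- move=> f /cellsP[]; rewrite inE => /andP[_ fs] fd j.
  have -> : f = s by apply/eqP; rewrite eqEcard fs fd sd leqnn.
  by rewrite setDv inE.
Qed.

End Insertion.

(** * Termination and correctness of the algorithm *)

Section FlippingTerminates.
Variables (R : realType) (d : nat) (I : finType) (p : I -> 'rV[R]_d) (A : {set I}).
Implicit Types (t : {set {set I}}).

(* The number of sets of simplices with a smaller value of the functional. *)
Let rank t := #|[set u | Vr p u < Vr p t]%SET|.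

Lemma nonoptimal_flip_rank t t' : nonoptimal_flip p A t t' -> (rank t' < rank t)%N.
Proof.
case=> _ [_ _ t't]; apply: proper_card; apply/properP; split.
  by apply/subsetP => u; rewrite !inE => /lt_trans; exact.
by exists t'; rewrite !inE ?ltxx.
Qed.

Lemma no_infinite_flipping : ~ exists t : nat -> {set {set I}},
  forall k, nonoptimal_flip p A (t k) (t k.+1).
Proof.
case=> t flips; have le_rank k : (k + rank (t k) <= rank (t 0))%N.
  elim: k => // k IHk; apply: leq_trans IHk.
  by rewrite addSnnS leq_add2l; exact: nonoptimal_flip_rank.
have := le_rank (rank (t 0)).+1.
by rewrite addSn ltnNge leq_addr.
Qed.

Lemma flipping_reaches_optimum t : exists2 t',
  clos_refl_trans_1n _ (nonoptimal_flip p A) t t' & locally_optimal p A t'.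
Proof.
have [m] := ubnP (rank t); elim: m => // m IHm in t *; rewrite ltnS => tm.
have [[t1 flip1]|opt] := pselect (exists t', nonoptimal_flip p A t t'); last first.
  by exists t => //; exact: rt1n_refl.
have [|t' steps opt'] := IHm t1; first exact: leq_trans (nonoptimal_flip_rank flip1) tm.
by exists t' => //; exact: rt1n_trans steps.
Qed.

Lemma flips_regular t t' : is_regular p A t ->
  clos_refl_trans_1n _ (nonoptimal_flip p A) t t' -> is_regular p A t'.
Proof. by move=> + steps; elim: steps => // u u' u'' [_ [_ reg _]] _ IH _; exact: IH. Qed.

End FlippingTerminates.

Section Runs.
Variables (R : realType) (d n : nat).
Variables (a : 'I_d.+1 -> 'rV[R]_d) (x : 'I_n -> 'rV[R]_d).
Hypothesis ha : artificial_simplex a x.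

Local Notation points := (all_points a x).
Local Notation S := (first_points d n).
Let p_gen : general_position points. Proof. by case: ha. Qed.
Let gen_lin (f : {set 'I_d.+1 + 'I_n}) : #|f| = d.+1 -> ~ on_hyperplane points f.
Proof. by case: p_gen => _ H _; exact: H. Qed.

Lemma first_points0E : S 0 = [set inl j | j : 'I_d.+1].
Proof.
apply/setP => -[j|j]; rewrite inE.
  by apply/esym/imsetP; exists j.
by rewrite ltn0; apply/esym/negbTE/negP => /imsetP[].
Qed.

Lemma card_first_points0 : #|S 0| = d.+1.
Proof. by rewrite first_points0E card_imset ?card_ord // => i j []. Qed.

Lemma first_points_sub i j : (i <= j)%N -> S i \subset S j.
Proof.
by move=> ij; apply/subsetP => -[k|k]; rewrite !inE // => /leq_trans; exact.
Qed.

Lemma first_pointsS (i : 'I_n) : S i.+1 = inr i |: S i.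
Proof.
apply/setP => -[j|j]; rewrite !inE //.
by rewrite ltnS leq_eqVlt; congr (_ || _).
Qed.

Lemma hull_first_points i j : hull points (S i) (x j).
Proof.
case: ha => _ /(_ j) + _ _; move=> /hullP[w [_ w1 wv] w0].
apply: (hull_sub (first_points_sub (leq0n i))); rewrite first_points0E.
exists (fun k => match k with inl k => w k | inr _ => 0 end).
have inlI : injective (@inl 'I_d.+1 'I_n) by move=> k k' [].
split; first by case=> k _ //.
  rewrite big_imset /=; last by move=> k k' _ _; exact: inlI.
  by rewrite -w1; apply: eq_bigl => k; rewrite ?inE.
rewrite big_imset /=; last by move=> k k' _ _; exact: inlI.
by rewrite -wv; apply: eq_bigl => k; rewrite ?inE.
Qed.

Lemma LOT_upto_regular i t : LOT_upto a x i t ->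
  is_regular points (S i) t /\ locally_optimal points (S i) t.
Proof.
elim=> [|{}i {}t t' _ [t_reg _] step].
  split; first exact: simplex_regular card_first_points0.
  case=> t' [_ [[T [_ [[TS Td] _ _ _]]] _ _]].
  by have := subset_leq_card TS; rewrite Td card_first_points0 ltnn.
have i_new : inr i \notin S i by rewrite inE ltnn.
case: step => [[opt ->]|[_ [s [[st sd] si steps opt]]]]; split=> //.
  apply: regular_same_hull t_reg; first exact: first_points_sub.
  by rewrite first_pointsS; apply: hull_setU1; exact: hull_first_points.
apply: flips_regular steps; rewrite first_pointsS.
exact: insert_point_regular.
Qed.

Lemma LOT_upto_delaunay i t : LOT_upto a x i t -> is_delaunay points (S i) t.
Proof.
move=> /LOT_upto_regular[t_reg opt].
by have [] := regular_flip_or_delaunay p_gen (first_points_sub (leq0n i)) card_first_points0 t_reg.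
Qed.

Lemma LOT_upto_ex i : (i <= n)%N -> exists t, LOT_upto a x i t.
Proof.
elim: i => [|i IHi] i_n; first by exists (faces (S 0)); exact: LOT_start.
have [t it] := IHi (ltnW i_n); pose k := Ordinal i_n.
have [[tS _] _] := LOT_upto_regular it.
have [opt|nopt] := pselect (locally_optimal points (S i.+1) t).
  by exists t; apply: (LOT_insert (i := k) it); left.
have [|s /cellsP[st sd] ks] := triangulation_covers gen_lin tS
    (first_points_sub (leq0n i)) card_first_points0 (v := x k).
  exact: hull_first_points.
have [t' steps opt'] := flipping_reaches_optimum points (S i.+1) (insert_point t s (inr k)).
exists t'; apply: (LOT_insert (i := k) it); right; split=> //.
by exists s.
Qed.

Lemma first_points_all : S n = [set: 'I_d.+1 + 'I_n].
Proof. by apply/setP => -[j|j]; rewrite !inE ?ltn_ord. Qed.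

End Runs.

Theorem theorem5 (R : realType) (d n : nat)
    (x : 'I_n -> 'rV[R]_d) (a : 'I_d.+1 -> 'rV[R]_d)
    (hx : general_position x) (ha : artificial_simplex a x) :
  [/\ flipping_terminates a x,
      exists t, LOT a x t
    & forall t, LOT a x t -> is_delaunay x [set: 'I_n] t].
Proof.
split=> [i _||t [u u_run ->]].
- exact: no_infinite_flipping.
- by have [u u_run] := LOT_upto_ex ha (leqnn n); exists (not_artificial u), u.
have [_ _ _] := ha; apply; rewrite -(first_points_all d n).
exact: LOT_upto_delaunay.
Qed.
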